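(* Let $W_2=\Bbbk\langle x,y\mid xy+yx=1\rangle$, let $\sigma\in\operatorname{Aut}(W_2)$ be given by $\sigma(x)=y$ and $\sigma(y)=x$, and set $S=W_2[t;\sigma]$, so that $S$ is generated by $x,y,t$ subject to the relations $$xy+yx=1,\qquad tx=yt,\qquad ty=xt.$$ Then $\operatorname{Aut}(S)\cong(\Bbbk^\times\times\{-1,1\})\rtimes\langle\tau\rangle$, where $\tau$ is the automorphism $x\leftrightarrow y$.
   Context: $\Bbbk$ is an algebraically closed field of characteristic zero, and all algebras are $\Bbbk$-algebras. $\operatorname{Aut}(S)$ is the group of $\Bbbk$-algebra automorphisms of $S$. For an algebra $A$ and $\sigma\in\operatorname{Aut}(A)$, the Ore extension $A[t;\sigma]$ is generated by $A$ and $t$ with the rule $ta=\sigma(a)t$ for all $a\in A$. $\langle\tau\rangle$ is the group generated by $\tau$. *)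

(* Defs.v *)
From HB Require Import structures.
From mathcomp Require Import all_boot all_algebra generic_quotient.
From mathcomp Require Import boolp.
From mathcomp Require Import finmap monalg.

Set Implicit Arguments.
Unset Strict Implicit.
Unset Printing Implicit Defensive.

Import GRing.Theory.
Local Open Scope ring_scope.
Local Open Scope quotient_scope.

Lemma malg_scalerAr (K : monomType) (k : comNzRingType) (c : k)
    (p q : {malg k[K]}) : c *: (p * q) = p * (c *: q).
Proof.
apply/malgP => w; rewrite mcoeffZ mcoeffMl.
rewrite (mcoeffMlw w (fsubset_refl (msupp p)) (msuppZ_le c q)).
rewrite big_distrr; apply: eq_bigr => i _; rewrite big_distrr.
by apply: eq_bigr => j _; rewrite /= mcoeffZ mulrnAr mulrCA.
Qed.

Definition freeAlg (k : comNzRingType) (n : nat) : Type :=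
  {malg k[{fmonom 'I_n}]}.

Section FreeAlg.
Variables (k : comNzRingType) (n : nat).
Local Notation F := (freeAlg k n).

HB.instance Definition _ := GRing.Lalgebra.on F.

HB.instance Definition _ := GRing.Lalgebra_isAlgebra.Build k F
  (@malg_scalerAr {fmonom 'I_n} k).

Definition freeX (i : 'I_n) : F := << fmu i >>.

Section Eval.
Variables (B : algType k) (u : 'I_n -> B).

Definition word_eval (w : {fmonom 'I_n}) : B := \prod_(i <- (w : seq _)) u i.

Definition freeEval (p : F) : B := mmap (in_alg B) word_eval p.

Fact freeEval_zmod : zmod_morphism freeEval.
Proof. exact: mmap_is_additive. Qed.

HB.instance Definition _ := GRing.isZmodMorphism.Build F B freeEval freeEval_zmod.

Let evalU c w : freeEval << c *g w >> = c *: word_eval w.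
Proof. by rewrite /freeEval mmapU /= mulr_algl. Qed.

Fact freeEval_monoid : GRing.monoid_morphism freeEval.
Proof.
split=> [|p q].
  by rewrite [LHS]evalU /word_eval fm1 big_nil scale1r.
rewrite [p * q]malgME.
transitivity (\sum_(i <- msupp p) \sum_(j <- msupp q)
    (p@_i *: word_eval i) * (q@_j *: word_eval j)).
  rewrite raddf_sum; apply: eq_bigr => i _.
  rewrite raddf_sum; apply: eq_bigr => j _.
  rewrite [LHS]evalU -scalerAl -scalerAr scalerA; congr (_ *: _).
  by rewrite /word_eval fmM big_cat.
rewrite /freeEval !mmapE mulr_suml; apply: eq_bigr => i _.
by rewrite mulr_sumr; apply: eq_bigr => j _; rewrite /= !mulr_algl.
Qed.

HB.instance Definition _ :=
  GRing.isMonoidMorphism.Build F B freeEval freeEval_monoid.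

Fact freeEval_scalable : scalable freeEval.
Proof.
move=> c p; rewrite /freeEval (mmapEw (msuppZ_le _ _)) mmapE scaler_sumr.
by apply: eq_bigr => i _; rewrite mcoeffZ /= !mulr_algl scalerA.
Qed.

HB.instance Definition _ :=
  GRing.isScalable.Build k F B *:%R freeEval freeEval_scalable.

Lemma freeEvalX i : freeEval (freeX i) = u i.
Proof. by rewrite /freeX evalU scale1r /word_eval fmU big_seq1. Qed.

End Eval.
End FreeAlg.

Record two_sided_ideal (A : nzRingType) (J : A -> Prop) : Prop := {
  ideal0 : J 0;
  idealD : forall a b, J a -> J b -> J (a + b);
  idealMl : forall a b, J b -> J (a * b);
  idealMr : forall a b, J a -> J (a * b) }.

Definition ideal_gen (A : nzRingType) (rels : seq A) (a : A) : Prop :=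
  forall J : A -> Prop,
    two_sided_ideal J -> (forall r, r \in rels -> J r) -> J a.

(* [A] is the algebra with generators [u i], [i < n], and defining relations
   [r = 0], [r \in rels]. *)
Definition presented_by (k : comNzRingType) (n : nat) (A : algType k)
    (u : 'I_n -> A) (rels : seq (freeAlg k n)) : Prop :=
  (forall a : A, exists p, freeEval u p = a) /\
  (forall p, freeEval u p = 0 <-> ideal_gen rels p).

Lemma ideal_gen_ideal (A : nzRingType) (rels : seq A) :
  two_sided_ideal (ideal_gen rels).
Proof.
split.
- by move=> J [].
- by move=> a b Ja Jb J iJ rJ; apply: (idealD iJ); [apply: Ja | apply: Jb].
- by move=> a b Jb J iJ rJ; apply: (idealMl iJ); apply: Jb.
- by move=> a b Ja J iJ rJ; apply: (idealMr iJ); apply: Ja.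
Qed.

Lemma ideal_gen_rel (A : nzRingType) (rels : seq A) r :
  r \in rels -> ideal_gen rels r.
Proof. by move=> rr J _ /(_ r rr). Qed.

Lemma ideal_gen_ker (A B : nzRingType) (f : {rmorphism A -> B}) (rels : seq A) :
  (forall r, r \in rels -> f r = 0) -> forall a, ideal_gen rels a -> f a = 0.
Proof.
move=> fr a /(_ (fun x => f x = 0)); apply=> //; split.
- exact: rmorph0.
- by move=> x y fx fy; rewrite rmorphD fx fy addr0.
- by move=> x y fy; rewrite rmorphM fy mulr0.
- by move=> x y fx; rewrite rmorphM fx mul0r.
Qed.

Record properIdeal (A : nzRingType) := ProperIdeal {
  ideal_pred :> A -> Prop;
  idealP : two_sided_ideal ideal_pred;
  ideal_proper : ~ ideal_pred 1 }.

Section QuotAlg.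
Variables (k : comNzRingType) (A : algType k) (I : properIdeal A).

Lemma properIdealN a : I a -> I (- a).
Proof. by move=> Ia; rewrite -mulN1r; apply: idealMl Ia; apply: idealP. Qed.

Lemma properIdealB a b : I a -> I b -> I (a - b).
Proof. by move=> Ia Ib; apply: (idealD (idealP I)) => //; apply: properIdealN. Qed.

Definition quot_equiv (x y : A) : bool := `[< I (x - y) >].

Lemma quot_equiv_is_equiv : equiv_class_of quot_equiv.
Proof.
split=> [x|x y|y x z]; rewrite /quot_equiv.
- by apply/asboolP; rewrite subrr; apply: ideal0 (idealP I).
- by apply/asboolP/asboolP => /properIdealN; rewrite opprB.
- move=> /asboolP xy /asboolP yz; apply/asboolP.
  by rewrite -[x](addrNK y) -addrA; apply: (idealD (idealP I)).
Qed.

Canonical quot_equiv_equiv := EquivRelPack quot_equiv_is_equiv.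
Canonical quot_equiv_encModRel := defaultEncModRel quot_equiv.

Definition quotAlg : Type := {eq_quot quot_equiv}%qT.
HB.instance Definition _ : EqQuotient A quot_equiv quotAlg := EqQuotient.on quotAlg.
HB.instance Definition _ := Choice.on quotAlg.

Definition quot_pi (a : A) : quotAlg := \pi_quotAlg%qT a.

Lemma quot_pi_eq a b : quot_pi a = quot_pi b <-> I (a - b).
Proof.
rewrite /quot_pi; split=> [ab|ab].
  by apply/asboolP; move/eqP: ab; rewrite piE.
by apply/eqP; rewrite piE; apply/asboolP.
Qed.

Lemma quot_pi_repr (x : quotAlg) : quot_pi (repr x) = x.
Proof. exact: reprK. Qed.

Lemma quot_repr_pi a : I (repr (quot_pi a) - a).
Proof. by apply/quot_pi_eq; rewrite quot_pi_repr. Qed.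

Let quot_add (x y : quotAlg) := quot_pi (repr x + repr y).
Let quot_opp (x : quotAlg) := quot_pi (- repr x).
Let quot_mul (x y : quotAlg) := quot_pi (repr x * repr y).
Let quot_scale (c : k) (x : quotAlg) := quot_pi (c *: repr x).

Let quot_piD a b : quot_pi (a + b) = quot_add (quot_pi a) (quot_pi b).
Proof.
apply/esym/quot_pi_eq; rewrite opprD addrACA.
by apply: (idealD (idealP I)); apply: quot_repr_pi.
Qed.

Let quot_piN a : quot_pi (- a) = quot_opp (quot_pi a).
Proof. by apply/esym/quot_pi_eq; rewrite -opprD; apply/properIdealN/quot_repr_pi. Qed.

Let quot_piM a b : quot_pi (a * b) = quot_mul (quot_pi a) (quot_pi b).
Proof.
apply/esym/quot_pi_eq.
rewrite -[_ * _](addrNK (a * repr (quot_pi b))) -mulrBl -addrA -mulrBr.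
apply: (idealD (idealP I)).
  by apply: (idealMr (idealP I)); apply: quot_repr_pi.
by apply: (idealMl (idealP I)); apply: quot_repr_pi.
Qed.

Let quot_piZ c a : quot_pi (c *: a) = quot_scale c (quot_pi a).
Proof.
apply/esym/quot_pi_eq; rewrite -scalerBr -mulr_algl.
by apply: (idealMl (idealP I)); apply: quot_repr_pi.
Qed.

Let quot_piE := (quot_piD, quot_piN, quot_piM, quot_piZ).

Fact quot_addA : associative quot_add.
Proof.
by move=> x y z; rewrite -[x]quot_pi_repr -[y]quot_pi_repr -[z]quot_pi_repr -!quot_piE addrA.
Qed.
Fact quot_addC : commutative quot_add.
Proof. by move=> x y; rewrite -[x]quot_pi_repr -[y]quot_pi_repr -!quot_piE addrC. Qed.
Fact quot_add0 : left_id (quot_pi 0) quot_add.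
Proof. by move=> x; rewrite -[x]quot_pi_repr -!quot_piE add0r. Qed.
Fact quot_addN : left_inverse (quot_pi 0) quot_opp quot_add.
Proof. by move=> x; rewrite -[x]quot_pi_repr -!quot_piE addNr. Qed.

HB.instance Definition _ := GRing.isZmodule.Build quotAlg quot_addA quot_addC quot_add0 quot_addN.

Fact quot_mulA : associative quot_mul.
Proof.
by move=> x y z; rewrite -[x]quot_pi_repr -[y]quot_pi_repr -[z]quot_pi_repr -!quot_piE mulrA.
Qed.
Fact quot_mul1 : left_id (quot_pi 1) quot_mul.
Proof. by move=> x; rewrite -[x]quot_pi_repr -!quot_piE mul1r. Qed.
Fact quot_mulr1 : right_id (quot_pi 1) quot_mul.
Proof. by move=> x; rewrite -[x]quot_pi_repr -!quot_piE mulr1. Qed.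
Fact quot_mulDl : left_distributive quot_mul quot_add.
Proof.
by move=> x y z; rewrite -[x]quot_pi_repr -[y]quot_pi_repr -[z]quot_pi_repr -!quot_piE mulrDl.
Qed.
Fact quot_mulDr : right_distributive quot_mul quot_add.
Proof.
by move=> x y z; rewrite -[x]quot_pi_repr -[y]quot_pi_repr -[z]quot_pi_repr -!quot_piE mulrDr.
Qed.
Fact quot_one_neq0 : quot_pi 1 != quot_pi 0.
Proof. by apply/eqP => /quot_pi_eq; rewrite subr0; apply: ideal_proper. Qed.

HB.instance Definition _ :=
  GRing.Zmodule_isNzRing.Build quotAlg quot_mulA quot_mul1 quot_mulr1 quot_mulDl quot_mulDr quot_one_neq0.

Fact quot_scaleA a b x : quot_scale a (quot_scale b x) = quot_scale (a * b) x.
Proof. by rewrite -[x]quot_pi_repr -!quot_piE scalerA. Qed.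
Fact quot_scale1 : left_id 1 quot_scale.
Proof. by move=> x; rewrite -[x]quot_pi_repr -!quot_piE scale1r. Qed.
Fact quot_scaleDr : right_distributive quot_scale quot_add.
Proof. by move=> a x y; rewrite -[x]quot_pi_repr -[y]quot_pi_repr -!quot_piE scalerDr. Qed.
Fact quot_scaleDl x : {morph quot_scale^~ x : a b / a + b >-> quot_add a b}.
Proof. by move=> a b; rewrite -[x]quot_pi_repr -!quot_piE scalerDl. Qed.

HB.instance Definition _ :=
  GRing.Zmodule_isLmodule.Build k quotAlg quot_scaleA quot_scale1 quot_scaleDr quot_scaleDl.

Fact quot_scaleAl a (x y : quotAlg) : a *: (x * y) = (a *: x) * y.
Proof.
by rewrite -[x]quot_pi_repr -[y]quot_pi_repr; rewrite -[LHS]/(quot_scale _ (quot_mul _ _))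
  -[RHS]/(quot_mul (quot_scale _ _) _) -!quot_piE scalerAl.
Qed.
HB.instance Definition _ := GRing.Lmodule_isLalgebra.Build k quotAlg quot_scaleAl.

Fact quot_scaleAr a (x y : quotAlg) : a *: (x * y) = x * (a *: y).
Proof.
by rewrite -[x]quot_pi_repr -[y]quot_pi_repr; rewrite -[LHS]/(quot_scale _ (quot_mul _ _))
  -[RHS]/(quot_mul _ (quot_scale _ _)) -!quot_piE scalerAr.
Qed.
HB.instance Definition _ := GRing.Lalgebra_isAlgebra.Build k quotAlg quot_scaleAr.

Fact quot_pi_zmod : zmod_morphism quot_pi.
Proof. by move=> a b; rewrite quot_piD quot_piN. Qed.
HB.instance Definition _ := GRing.isZmodMorphism.Build A quotAlg quot_pi quot_pi_zmod.
Fact quot_pi_monoid : GRing.monoid_morphism quot_pi.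
Proof. by split=> // a b; rewrite quot_piM. Qed.
HB.instance Definition _ := GRing.isMonoidMorphism.Build A quotAlg quot_pi quot_pi_monoid.
Fact quot_pi_scalable : scalable quot_pi.
Proof. by move=> c a; rewrite quot_piZ. Qed.
HB.instance Definition _ := GRing.isScalable.Build k A quotAlg *:%R quot_pi quot_pi_scalable.

Lemma quot_pi_eq0 a : quot_pi a = 0 <-> I a.
Proof. by rewrite -[0]/(quot_pi 0) quot_pi_eq subr0. Qed.

Section Lift.
Variables (B : algType k) (f : {lrmorphism A -> B}).
Hypothesis fI : forall a, I a -> f a = 0.

Definition quot_lift (x : quotAlg) : B := f (repr x).

Lemma quot_lift_pi a : quot_lift (quot_pi a) = f a.
Proof.
by apply/eqP; rewrite /quot_lift -subr_eq0 -raddfB; apply/eqP/fI/quot_repr_pi.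
Qed.

Fact quot_lift_linear : linear quot_lift.
Proof.
move=> c x y; rewrite -[x]quot_pi_repr -[y]quot_pi_repr -linearP !quot_lift_pi.
exact: linearP.
Qed.

Fact quot_lift_monoid : GRing.monoid_morphism quot_lift.
Proof.
split=> [|x y]; first by rewrite -[1]/(quot_pi 1) quot_lift_pi rmorph1.
by rewrite -[x]quot_pi_repr -[y]quot_pi_repr -rmorphM !quot_lift_pi rmorphM.
Qed.

End Lift.
End QuotAlg.

Section AlgAut.
Variables (k : comNzRingType) (A : algType k).

Record algAut : Type := AlgAut {
  aut_fun :> A -> A;
  aut_linear : linear aut_fun;
  aut_monoid : GRing.monoid_morphism aut_fun;
  aut_bij : bijective aut_fun }.

HB.instance Definition _ (s : algAut) :=
  GRing.isLinear.Build k A A *:%R (aut_fun s) (aut_linear s).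
HB.instance Definition _ (s : algAut) :=
  GRing.isMonoidMorphism.Build A A (aut_fun s) (aut_monoid s).

HB.instance Definition _ := gen_eqMixin algAut.
HB.instance Definition _ := gen_choiceMixin algAut.

Lemma algAutP (s r : algAut) : s =1 r -> s = r.
Proof.
case: s r => [f fl fm fb] [g gl gm gb] /= /funext fg.
by subst g; congr AlgAut; apply: Prop_irrelevance.
Qed.

Definition aut1 : algAut.
Proof.
by apply: (@AlgAut id) => //; exists id.
Defined.

Definition autM (s r : algAut) : algAut.
Proof.
apply: (@AlgAut (s \o r)).
- by move=> c x y /=; rewrite !linearP.
- by split=> [|x y] /=; rewrite ?rmorph1 ?rmorphM.
- exact: bij_comp (aut_bij s) (aut_bij r).
Defined.

Fact autV_subproof (s : algAut) : {r : A -> A | cancel s r & cancel r s}.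
Proof.
by case: (cid (let: Bijective r h h' := aut_bij s in
  ex_intro (fun r => cancel s r /\ cancel r s) r (conj h h'))) => r [h h']; exists r.
Qed.

Definition autV (s : algAut) : algAut.
Proof.
case: (autV_subproof s) => r sr rs.
apply: (@AlgAut r).
- exact: can2_linear sr rs.
- exact: can2_monoid_morphism sr rs.
- by exists s.
Defined.

Fact autMA : associative autM. Proof. by move=> s r u; apply: algAutP. Qed.
Fact aut1M : left_id aut1 autM. Proof. by move=> s; apply: algAutP. Qed.
Fact autM1 : right_id aut1 autM. Proof. by move=> s; apply: algAutP. Qed.
Fact autVM : left_inverse aut1 autV autM.
Proof.
by move=> s; apply: algAutP => x; rewrite /autM /autV /=; case: autV_subproof => r /=.
Qed.
Fact autMV : right_inverse aut1 autV autM.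
Proof.
by move=> s; apply: algAutP => x; rewrite /autM /autV /=; case: autV_subproof => r /=.
Qed.

HB.instance Definition _ := isGroup.Build algAut autMA aut1M autM1 autVM autMV.

End AlgAut.

(* [ore s] is the Ore extension [A[t; s]]: the element [\sum_i a_i t^i] is
   represented by the polynomial with coefficients [a_i], and the product is
   determined by [(a t^i) (b t^j) = a s^i(b) t^(i+j)]. *)
Definition ore (k : comNzRingType) (A : algType k) (s : algAut A) : Type :=
  {poly A}.

Section Ore.
Variables (k : comNzRingType) (A : algType k) (s : algAut A).
Implicit Types (p q r : {poly A}) (a b : A) (c : k).

Definition ore_mul p q : {poly A} :=
  \sum_(i < size p) p`_i *: (map_poly (s ^+ i)%g q * 'X^i).

Lemma ore_mulE N p q : (size p <= N)%N ->
  ore_mul p q = \sum_(i < N) p`_i *: (map_poly ((s ^+ i)%g) q * 'X^i).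
Proof.
move=> pN; rewrite /ore_mul (big_ord_widen N
  (fun i => p`_i *: (map_poly ((s ^+ i)%g) q * 'X^i)) pN) big_mkcond.
apply: eq_bigr => i _; case: ifPn => //.
by rewrite -leqNgt => ?; rewrite nth_default ?scale0r.
Qed.

Lemma ore_mulDl : left_distributive ore_mul +%R.
Proof.
move=> p q r; pose N := maxn (size p) (size q).
rewrite !(@ore_mulE N) ?leq_maxl ?leq_maxr ?size_polyD // -big_split /=.
by apply: eq_bigr => i _; rewrite coefD scalerDl.
Qed.

Lemma ore_mulDr : right_distributive ore_mul +%R.
Proof.
move=> p q r; rewrite /ore_mul -big_split /=; apply: eq_bigr => i _.
by rewrite raddfD /= mulrDl scalerDr.
Qed.

Lemma ore_mul0 p : ore_mul 0 p = 0. Proof. by rewrite /ore_mul size_poly0 big_ord0. Qed.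

Lemma ore_mulp0 p : ore_mul p 0 = 0.
Proof. by rewrite /ore_mul big1 // => i _; rewrite raddf0 mul0r scaler0. Qed.

Lemma ore_mulXn a b i j : ore_mul (a *: 'X^i) (b *: 'X^j) = (a * (s ^+ i)%g b) *: 'X^(i + j).
Proof.
rewrite (@ore_mulE i.+1); last first.
  by apply: leq_trans (size_scale_leq _ _) _; rewrite size_polyXn.
rewrite big_ord_recr /= big1 ?add0r => [|l _]; last first.
  by rewrite coefZ coefXn ltn_eqF // mulr0 scale0r.
rewrite coefZ coefXn eqxx mulr1 linearZ_LR /= ?map_polyZ /= map_polyXn.
by rewrite -scalerAl scalerA -exprD addnC.
Qed.

Let ore_mono p : p = \sum_(i < size p) p`_i *: 'X^i.
Proof. by rewrite -poly_def coefK. Qed.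

Let ore_mul_ind (P : {poly A} -> Prop) :
  P 0 -> (forall p q, P p -> P q -> P (p + q)) ->
  (forall a i, P (a *: 'X^i)) -> forall p, P p.
Proof. by move=> P0 PD PX p; rewrite (ore_mono p); apply: big_ind => // i _. Qed.

Lemma ore_mulA : associative ore_mul.
Proof.
elim/ore_mul_ind => [q r|p p' IHp IHp' q r|a i]; first by rewrite !ore_mul0.
  by rewrite !ore_mulDl IHp IHp'.
elim/ore_mul_ind => [r|q q' IHq IHq' r|b j]; first by rewrite ore_mulp0 !ore_mul0 ore_mulp0.
  by rewrite ore_mulDr !ore_mulDl ore_mulDr IHq IHq'.
elim/ore_mul_ind => [|r r' IHr IHr'|c l]; first by rewrite !ore_mulp0.
  by rewrite !ore_mulDr IHr IHr'.
by rewrite !ore_mulXn addnA rmorphM mulrA expgnDr.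
Qed.

Let ore_polyC1E : 1%:P = 1 *: 'X^0 :> {poly A}.
Proof. by rewrite expr0 scale1r. Qed.

Lemma ore_mul1 : left_id 1%:P ore_mul.
Proof.
elim/ore_mul_ind => [|p q IHp IHq|a i]; first exact: ore_mulp0.
  by rewrite ore_mulDr IHp IHq.
by rewrite ore_polyC1E ore_mulXn add0n mul1r.
Qed.

Lemma ore_mulp1 : right_id 1%:P ore_mul.
Proof.
elim/ore_mul_ind => [|p q IHp IHq|a i]; first exact: ore_mul0.
  by rewrite ore_mulDl IHp IHq.
by rewrite ore_polyC1E ore_mulXn addn0 rmorph1 mulr1.
Qed.

HB.instance Definition _ := GRing.Zmodule.on (ore s).

Fact ore_one_neq0 : (1%:P : ore s) != 0.
Proof. exact: oner_neq0. Qed.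

HB.instance Definition _ :=
  GRing.Zmodule_isNzRing.Build (ore s) ore_mulA ore_mul1 ore_mulp1 ore_mulDl ore_mulDr ore_one_neq0.

Definition ore_scale (c : k) (p : ore s) : ore s := c%:A *: (p : {poly A}).

Fact ore_scaleA c d p : ore_scale c (ore_scale d p) = ore_scale (c * d) p.
Proof. by rewrite /ore_scale scalerA mulr_algl scalerA. Qed.
Fact ore_scale1 : left_id 1 ore_scale.
Proof. by move=> p; rewrite /ore_scale !scale1r. Qed.
Fact ore_scaleDr : right_distributive ore_scale +%R.
Proof. by move=> c p q; rewrite /ore_scale [LHS]scalerDr. Qed.
Fact ore_scaleDl p : {morph ore_scale^~ p : c d / c + d}.
Proof. by move=> c d; rewrite /ore_scale scalerDl [LHS]scalerDl. Qed.

HB.instance Definition _ :=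
  GRing.Zmodule_isLmodule.Build k (ore s) ore_scaleA ore_scale1 ore_scaleDr ore_scaleDl.

Let ore_scaleX c a i : ore_scale c (a *: 'X^i) = (c *: a) *: 'X^i.
Proof. by rewrite /ore_scale scalerA mulr_algl. Qed.

Fact ore_scaleAl c (p q : ore s) : c *: (p * q) = (c *: p) * q.
Proof.
rewrite -[LHS]/(ore_scale c (ore_mul p q)) -[RHS]/(ore_mul (ore_scale c p) q).
move: p q; elim/ore_mul_ind => [q|p p' IHp IHp' q|a i].
- by rewrite ore_mul0 /ore_scale [in LHS]scaler0 [X in ore_mul X]scaler0 ore_mul0.
- by rewrite ore_mulDl !ore_scaleDr ore_mulDl IHp IHp'.
elim/ore_mul_ind => [|q q' IHq IHq'|b j].
- by rewrite !ore_mulp0 /ore_scale [in LHS]scaler0.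
- by rewrite !ore_mulDr ore_scaleDr IHq IHq'.
by rewrite ore_mulXn !ore_scaleX ore_mulXn scalerAl.
Qed.

HB.instance Definition _ := GRing.Lmodule_isLalgebra.Build k (ore s) ore_scaleAl.

Fact ore_scaleAr c (p q : ore s) : c *: (p * q) = p * (c *: q).
Proof.
rewrite -[LHS]/(ore_scale c (ore_mul p q)) -[RHS]/(ore_mul p (ore_scale c q)).
move: p q; elim/ore_mul_ind => [q|p p' IHp IHp' q|a i].
- by rewrite !ore_mul0 /ore_scale [LHS]scaler0.
- by rewrite !ore_mulDl !ore_scaleDr IHp IHp'.
elim/ore_mul_ind => [|q q' IHq IHq'|b j].
- by rewrite ore_mulp0 /ore_scale [in LHS]scaler0 [X in ore_mul _ X]scaler0 ore_mulp0.
- by rewrite !ore_mulDr !ore_scaleDr ore_mulDr IHq IHq'.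
by rewrite ore_mulXn !ore_scaleX ore_mulXn linearZ /= scalerAr.
Qed.

HB.instance Definition _ := GRing.Lalgebra_isAlgebra.Build k (ore s) ore_scaleAr.

Definition ore_inj (a : A) : ore s := a%:P.
Definition ore_t : ore s := 'X.

Let ore_injE a : ore_inj a = a *: 'X^0 :> {poly A}.
Proof. by rewrite expr0 alg_polyC. Qed.

Fact ore_inj_linear : linear ore_inj.
Proof.
move=> c a b; rewrite /ore_inj polyCD -[in LHS](alg_polyC (c *: a)) -(expr0 'X).
by rewrite -ore_scaleX expr0 alg_polyC.
Qed.

Fact ore_inj_monoid : GRing.monoid_morphism ore_inj.
Proof.
split=> // a b; rewrite -[RHS]/(ore_mul _ _) !ore_injE ore_mulXn.
by rewrite addn0 expg0.
Qed.

HB.instance Definition _ :=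
  GRing.isLinear.Build k A (ore s) *:%R ore_inj ore_inj_linear.
HB.instance Definition _ :=
  GRing.isMonoidMorphism.Build A (ore s) ore_inj ore_inj_monoid.

Lemma ore_tM a : ore_t * ore_inj a = ore_inj (s a) * ore_t.
Proof.
have tE : ore_t = (1 *: 'X^1 : {poly A}) by rewrite scale1r expr1.
have iE b : ore_inj b = (b *: 'X^0 : {poly A}) by rewrite expr0 alg_polyC.
rewrite -[LHS]/(ore_mul ore_t (ore_inj a)) -[RHS]/(ore_mul (ore_inj (s a)) ore_t) tE !iE !ore_mulXn.
by rewrite mul1r mulr1 addn0 add0n expg1.
Qed.

Lemma ore_mul_inj_tX a i : ore_inj a * ore_t ^+ i = a *: 'X^i :> {poly A}.
Proof.
elim: i a => [|i IH] a; first by rewrite expr0 mulr1 expr0 alg_polyC.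
have tE : ore_t = (1 *: 'X^1 : {poly A}) by rewrite scale1r expr1.
rewrite exprSr mulrA IH -[LHS]/(ore_mul _ ore_t) tE ore_mulXn rmorph1 mulr1.
by rewrite addn1.
Qed.

End Ore.

Section W2.
Variable k : comNzRingType.

Definition W2_rel : freeAlg k 2 :=
  freeX k 0 * freeX k 1 + freeX k 1 * freeX k 0 - 1.

Lemma freeEval_W2_rel (B : algType k) (u : 'I_2 -> B) :
  freeEval u W2_rel = u 0 * u 1 + u 1 * u 0 - 1.
Proof.
rewrite /W2_rel rmorphB /= rmorphD /= rmorph1.
by rewrite [X in X + _ - _]rmorphM [X in _ + X - _]rmorphM /= !freeEvalX.
Qed.

Fact W2_rel_proper : ~ ideal_gen [:: W2_rel] 1.
Proof.
pose u (i : 'I_2) : 'M[k]_2 := delta_mx i (rev_ord i).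
have rev0 : rev_ord (0 : 'I_2) = 1 by apply: val_inj.
have rev1 : rev_ord (1 : 'I_2) = 0 by apply: val_inj.
have u_rel r : r \in [:: W2_rel] -> freeEval u r = 0.
  rewrite inE => /eqP ->; rewrite freeEval_W2_rel /u rev0 rev1 -!mulmxE.
  rewrite !mul_delta_mx; apply/eqP; rewrite subr_eq0; apply/eqP/matrixP => i j.
  by rewrite !mxE; case: i j => [[|[|i]] hi] [[|[|j]] hj];
    rewrite //= ?addr0 ?add0r.
move=> /(ideal_gen_ker u_rel); rewrite rmorph1 => /eqP.
by rewrite oner_eq0.
Qed.

Definition W2_ideal : properIdeal (freeAlg k 2) :=
  ProperIdeal (ideal_gen_ideal [:: W2_rel]) W2_rel_proper.

Definition W2 : algType k := quotAlg W2_ideal.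

Definition W2_gen (i : 'I_2) : W2 := quot_pi W2_ideal (freeX k i).
Definition W2x : W2 := W2_gen 0.
Definition W2y : W2 := W2_gen 1.

Lemma freeAlg_ind (n : nat) (P : freeAlg k n -> Prop) :
  P 1 -> (forall c p, P p -> P (c *: p)) ->
  (forall p q, P p -> P q -> P (p + q)) ->
  (forall i p, P p -> P (freeX k i * p)) -> forall p, P p.
Proof.
move=> P1 PZ PD PX p; rewrite [p]monalgE; apply: (big_ind P) => //.
  by rewrite -(scale0r 1); apply: PZ.
move=> w _; have -> : << p@_w *g w >> = p@_w *: (<< w >> : freeAlg k n).
  by apply/malgP => v; rewrite mcoeffZ !mcoeffU mulrb mulrnAr mulr1 mulrb.
apply: PZ; rewrite -(fmK w); elim: (w : seq _) => [|i v IH].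
  by rewrite -fmoneE.
rewrite (_ : << _ >> = freeX k i * << FMonom v >>); first exact: PX.
rewrite [RHS](@fgmulUU {fmonom 'I_n} k) mulr1; congr << _ >>.
by rewrite [RHS]fmmulE fmuE.
Qed.

Lemma freeEval_pi (n : nat) (I : properIdeal (freeAlg k n)) (p : freeAlg k n) :
  freeEval (fun i => quot_pi I (freeX k i)) p = quot_pi I p.
Proof.
elim/freeAlg_ind: p => [|c p IH|p q IHp IHq|i p IH].
- by rewrite !rmorph1.
- by rewrite !linearZ /= IH.
- by rewrite !raddfD /= IHp IHq.
- by rewrite [LHS]rmorphM [RHS]rmorphM /= IH freeEvalX.
Qed.

Lemma W2_presented : presented_by W2_gen [:: W2_rel].
Proof.
split=> [a|p]; last by rewrite freeEval_pi; apply: quot_pi_eq0.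
by exists (repr a); rewrite freeEval_pi; apply: quot_pi_repr.
Qed.

Lemma W2_xy : W2x * W2y + W2y * W2x = 1.
Proof.
apply/eqP; rewrite -subr_eq0 -(freeEval_W2_rel W2_gen); apply/eqP.
by apply: (proj2 (W2_presented.2 _)); apply: ideal_gen_rel; apply: mem_head.
Qed.

Let swap_free (p : freeAlg k 2) : W2 :=
  freeEval (fun i => W2_gen (rev_ord i)) p.

Fact swap_free_rel p : W2_ideal p -> swap_free p = 0.
Proof.
have rev0 : rev_ord (0 : 'I_2) = 1 by apply: val_inj.
have rev1 : rev_ord (1 : 'I_2) = 0 by apply: val_inj.
apply: (ideal_gen_ker (f := freeEval (fun i => W2_gen (rev_ord i)))) => r.
rewrite mem_seq1 => /eqP -> /=; rewrite freeEval_W2_rel rev0 rev1 [X in X - 1]addrC.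
by rewrite -[X in X - 1]/(W2x * W2y + W2y * W2x) W2_xy subrr.
Qed.

Definition swap_fun : W2 -> W2 :=
  quot_lift (freeEval (fun i => W2_gen (rev_ord i))).

Fact swap_fun_gen i : swap_fun (W2_gen i) = W2_gen (rev_ord i).
Proof. by rewrite /swap_fun (quot_lift_pi swap_free_rel) /= freeEvalX. Qed.

Fact swap_fun_linear : linear swap_fun.
Proof. exact: quot_lift_linear swap_free_rel. Qed.

Fact swap_fun_monoid : GRing.monoid_morphism swap_fun.
Proof. exact: quot_lift_monoid swap_free_rel. Qed.

HB.instance Definition _ :=
  GRing.isLinear.Build k W2 W2 *:%R swap_fun swap_fun_linear.
HB.instance Definition _ :=
  GRing.isMonoidMorphism.Build W2 W2 swap_fun swap_fun_monoid.

Fact swap_funK : involutive swap_fun.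
Proof.
have f1 : swap_fun (swap_fun 1) = 1 by rewrite (rmorph1 swap_fun) rmorph1.
have fD u v : swap_fun (swap_fun (u + v)) =
    swap_fun (swap_fun u) + swap_fun (swap_fun v).
  by rewrite (raddfD swap_fun u v) raddfD.
have fM u v : swap_fun (swap_fun (u * v)) =
    swap_fun (swap_fun u) * swap_fun (swap_fun v).
  by rewrite (rmorphM swap_fun u v) rmorphM.
have fZ c u : swap_fun (swap_fun (c *: u)) = c *: swap_fun (swap_fun u).
  by rewrite (linearZ_LR swap_fun c u) linearZ_LR.
move=> a; rewrite -[a]quot_pi_repr.
elim/freeAlg_ind: (repr a) => [|c p IH|p q IHp IHq|i p IH].
- exact: f1.
- have -> : quot_pi W2_ideal (c *: p) = c *: quot_pi W2_ideal p.
    exact: linearZ_LR.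
  by rewrite fZ IH.
- have -> : quot_pi W2_ideal (p + q) = quot_pi W2_ideal p + quot_pi W2_ideal q.
    exact: raddfD.
  by rewrite fD; exact: f_equal2 IHp IHq.
have -> : quot_pi W2_ideal (freeX k i * p) = W2_gen i * quot_pi W2_ideal p.
  exact: rmorphM.
rewrite fM; apply: f_equal2 IH.
by rewrite (swap_fun_gen i) (swap_fun_gen (rev_ord i)) rev_ordK.
Qed.

Definition W2_swap : algAut W2 :=
  AlgAut swap_fun_linear swap_fun_monoid (inv_bij swap_funK).

Lemma W2_swap_x : W2_swap W2x = W2y.
Proof. by rewrite [LHS]swap_fun_gen; congr W2_gen; apply: val_inj. Qed.

Lemma W2_swap_y : W2_swap W2y = W2x.
Proof. by rewrite [LHS]swap_fun_gen; congr W2_gen; apply: val_inj. Qed.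

End W2.

Section Salg.
Variable k : comNzRingType.

Definition Salg : algType k := ore (W2_swap k).

Definition Sx : Salg := ore_inj (W2_swap k) (W2x k).
Definition Sy : Salg := ore_inj (W2_swap k) (W2y k).
Definition St : Salg := ore_t (W2_swap k).

Definition S_gen : 'I_3 -> Salg := tnth [tuple Sx; Sy; St].

Definition S_rels : seq (freeAlg k 3) :=
  let X := freeX k 0 in let Y := freeX k 1 in let T := freeX k 2 in
  [:: X * Y + Y * X - 1; T * X - Y * T; T * Y - X * T].

Lemma S_gen0 : S_gen 0 = Sx. Proof. by []. Qed.
Lemma S_gen1 : S_gen 1 = Sy. Proof. by []. Qed.
Lemma S_gen2 : S_gen 2 = St. Proof. by []. Qed.

Lemma S_xy : Sx * Sy + Sy * Sx = 1.
Proof.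
pose h := ore_inj (W2_swap k).
have hD : h (W2x k * W2y k + W2y k * W2x k) =
    h (W2x k * W2y k) + h (W2y k * W2x k) by exact: raddfD.
have hM a b : h (a * b) = h a * h b by exact: rmorphM.
have h1 : h 1 = 1 by exact: rmorph1.
by move: hD; rewrite W2_xy h1 (hM (W2x k) (W2y k)) (hM (W2y k) (W2x k)).
Qed.

Lemma S_tx : St * Sx = Sy * St.
Proof. by rewrite [LHS]ore_tM W2_swap_x. Qed.

Lemma S_ty : St * Sy = Sx * St.
Proof. by rewrite [LHS]ore_tM W2_swap_y. Qed.

End Salg.

Section FieldUnits.
Variable k : fieldType.

Record fieldUnits : Type := FieldUnit {
  unit_val :> k; _ : unit_val != 0 }.

HB.instance Definition _ := [isSub for unit_val].
HB.instance Definition _ := [Choice of fieldUnits by <:].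

Implicit Types u v w : fieldUnits.

Lemma unit_val_neq0 u : unit_val u != 0. Proof. exact: (valP u). Qed.

Definition fu_one := FieldUnit (oner_neq0 k).
Definition fu_mul u v :=
  FieldUnit (mulf_neq0 (unit_val_neq0 u) (unit_val_neq0 v)).
Definition fu_inv u := FieldUnit (invr_neq0 (unit_val_neq0 u)).

Fact fu_mulA : associative fu_mul.
Proof. by move=> u v w; apply: val_inj; apply: mulrA. Qed.
Fact fu_mul1 : left_id fu_one fu_mul.
Proof. by move=> u; apply: val_inj; apply: mul1r. Qed.
Fact fu_mulr1 : right_id fu_one fu_mul.
Proof. by move=> u; apply: val_inj; apply: mulr1. Qed.
Fact fu_mulV : left_inverse fu_one fu_inv fu_mul.
Proof. by move=> u; apply/val_inj/mulVf/unit_val_neq0. Qed.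
Fact fu_mulrV : right_inverse fu_one fu_inv fu_mul.
Proof. by move=> u; apply/val_inj/mulfV/unit_val_neq0. Qed.

HB.instance Definition _ :=
  isGroup.Build fieldUnits fu_mulA fu_mul1 fu_mulr1 fu_mulV fu_mulrV.

Definition is_sign (u : fieldUnits) : bool :=
  (unit_val u == 1) || (unit_val u == -1).

Record signs : Type := Sign { sign_val :> fieldUnits; _ : is_sign sign_val }.

HB.instance Definition _ := [isSub for sign_val].
HB.instance Definition _ := [Choice of signs by <:].

Fact is_sign_group : group_closed is_sign.
Proof.
split=> [|u v]; first by rewrite unfold_in /is_sign eqxx.
rewrite !unfold_in /is_sign => /orP[] /eqP eu /orP[] /eqP ev;
  rewrite -[unit_val (u / v)%g]/(unit_val u / unit_val v) eu ev;
  by rewrite ?invrN ?invr1 ?mulrNN ?mulrN ?mulr1 ?eqxx ?orbT.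
Qed.

HB.instance Definition _ :=
  SubChoice_isSubGroup.Build fieldUnits is_sign signs is_sign_group.

End FieldUnits.

Section GeneratedSubgroup.
Variables (G : groupType) (g : G).

Definition in_cyclic (h : G) : bool :=
  `[< forall H : {pred G}, group_closed H -> g \in H -> h \in H >].

Record cyclicGroup : Type := CyclicGroup { cyclic_val :> G; _ : in_cyclic cyclic_val }.

HB.instance Definition _ := [isSub for cyclic_val].
HB.instance Definition _ := [Choice of cyclicGroup by <:].

Fact in_cyclic_group : group_closed in_cyclic.
Proof.
split=> [|u v]; rewrite !unfold_in.
  by apply/asboolP => H [].
move=> /asboolP uH /asboolP vH; apply/asboolP => H gH Hg.
by apply: gH.2; [apply: uH | apply: vH].
Qed.

HB.instance Definition _ :=
  SubChoice_isSubGroup.Build G in_cyclic cyclicGroup in_cyclic_group.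

End GeneratedSubgroup.

Record groupAct (N H : groupType) : Type := GroupAct {
  act_fun :> H -> N -> N;
  actM : forall h, {morph act_fun h : a b / (a * b)%g};
  act1 : forall a, act_fun 1%g a = a;
  act_mul : forall h h' a, act_fun (h * h')%g a = act_fun h (act_fun h' a) }.

Definition sdprod (N H : groupType) (theta : groupAct N H) : Type :=
  (N * H)%type.

Section Sdprod.
Variables (N H : groupType) (theta : groupAct N H).
Local Open Scope group_scope.

HB.instance Definition _ := Choice.on (sdprod theta).

Implicit Types u v w : sdprod theta.

Definition sd_one : sdprod theta := (1, 1).
Definition sd_mul u v : sdprod theta := (u.1 * theta u.2 v.1, u.2 * v.2).
Definition sd_inv u : sdprod theta := (theta u.2^-1 u.1^-1, u.2^-1).

Lemma act_one h : theta h 1 = 1.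
Proof. by apply: (mulgI (theta h 1)); rewrite -actM !mulg1. Qed.

Fact sd_mulA : associative sd_mul.
Proof.
by move=> u v w; rewrite /sd_mul /= actM act_mul !mulgA.
Qed.
Fact sd_mul1 : left_id sd_one sd_mul.
Proof. by case=> n h; rewrite /sd_mul /= act1 !mul1g. Qed.
Fact sd_mulg1 : right_id sd_one sd_mul.
Proof. by case=> n h; rewrite /sd_mul /= act_one !mulg1. Qed.
Fact sd_mulV : left_inverse sd_one sd_inv sd_mul.
Proof. by case=> n h; rewrite /sd_mul /= -actM !mulVg act_one. Qed.
Fact sd_mulgV : right_inverse sd_one sd_inv sd_mul.
Proof. by case=> n h; rewrite /sd_mul /= -act_mul !mulgV act1 mulgV. Qed.

HB.instance Definition _ :=
  isGroup.Build (sdprod theta) sd_mulA sd_mul1 sd_mulg1 sd_mulV sd_mulgV.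

End Sdprod.

(* Main.v *)
(* Write p = x^2 and z = xy - yx. The algebra W_2 is a free right module over
   k[p, y] with basis 1, x; the determinant of left multiplication is a
   multiplicative norm whose degree in p is the x-degree, so the x-degree and,
   through the swap, the y-degree are additive and W_2 is a domain.

   Let f be an automorphism of S. A normal element n of S with nonzero constant
   coefficient satisfies n x = +-x n and n y = +-y n, by comparison of degrees
   and because p is central in W_2.
   - For n = f(t) both signs are + and n commutes with t, as one sees by mapping
     x and y to r with 2 r^2 = 1 and t to itself in k[t]: the image of f(t) is
     nonzero there. Then f(t) is central, which is absurd, so t divides f(t).
     Applying this to the inverse of f gives f(t) = c t.
   - For n = f(z) both signs are -, which forces z to divide f(z), and likewise
     f(z) = d z.
   Hence 2 f(x) f(y) = 1 + d z, and the degrees leave only f(x) = e x or e y,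
   with e^2 = 1 because t f(x) = f(y) t. *)

Require Import Defs.
From HB Require Import structures.
From mathcomp Require Import all_boot all_algebra.
From mathcomp Require Import boolp ring zify.

Set Implicit Arguments.
Unset Strict Implicit.
Unset Printing Implicit Defensive.

Import GRing.Theory.
Local Open Scope ring_scope.

(** * Algebras given by generators and relations *)

Section Presentation.
Variables (k : comNzRingType) (n : nat) (A : algType k) (u : 'I_n -> A).
Variable rels : seq (freeAlg k n).
Hypothesis pres : presented_by u rels.

Lemma presented_ind (P : A -> Prop) :
  P 1 -> (forall c a, P a -> P (c *: a)) ->
  (forall a b, P a -> P b -> P (a + b)) ->
  (forall i a, P a -> P (u i * a)) -> forall a, P a.
Proof.
move=> P1 PZ PD PX a; have [p <-] := pres.1 a.
elim/freeAlg_ind: p => [|c p IH|p q IHp IHq|i p IH].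
- by rewrite rmorph1.
- by rewrite linearZ; apply: PZ.
- by rewrite raddfD; apply: PD.
- by rewrite rmorphM /= freeEvalX; apply: PX.
Qed.

Lemma presented_rel r : r \in rels -> freeEval u r = 0.
Proof. by move=> rr; apply/pres.2; apply: ideal_gen_rel. Qed.

Section Lift.
Variables (B : algType k) (v : 'I_n -> B).
Hypothesis vrels : forall r, r \in rels -> freeEval v r = 0.

Let lift (a : A) : B := freeEval v (projT1 (cid (pres.1 a))).

(** Independence of the chosen preimage: two preimages differ by an element of the ideal of
    relations, which [freeEval v] kills. *)
Let liftE p : lift (freeEval u p) = freeEval v p.
Proof.
rewrite /lift; case: cid => q /= pq; apply/eqP; rewrite -subr_eq0 -raddfB.
apply/eqP/(ideal_gen_ker vrels)/pres.2.
by rewrite raddfB /= pq subrr.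
Qed.

Let lift_linear : linear lift.
Proof.
move=> c a b; have [[p <-] [q <-]] := (pres.1 a, pres.1 b).
by rewrite -linearP !liftE linearP.
Qed.

Let lift_monoid : GRing.monoid_morphism lift.
Proof.
split=> [|a b]; first by rewrite -(rmorph1 (freeEval u)) liftE rmorph1.
have [[p <-] [q <-]] := (pres.1 a, pres.1 b).
by rewrite -rmorphM !liftE rmorphM.
Qed.

HB.instance Definition _ := GRing.isLinear.Build k A B *:%R lift lift_linear.
HB.instance Definition _ := GRing.isMonoidMorphism.Build A B lift lift_monoid.

(** The universal property; it yields the matrix representation of W_2, the morphism from S to k[t]
    and the endomorphisms of S. *)
Lemma presented_lift : exists f : {lrmorphism A -> B}, forall i, f (u i) = v i.
Proof. by exists lift => i; rewrite -(freeEvalX v i) -liftE freeEvalX. Qed.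

End Lift.
End Presentation.

(** * Degrees in the algebra W_2 *)

(* The variable of the outer polynomials stands for [x ^+ 2], that of the inner
   ones for [y]; the alias carries the structure of an algebra over [k] instead
   of [{poly {poly k}}]. *)
Definition pmat (k : comNzRingType) : Type := 'M[{poly {poly k}}]_2.

(** * Two by two matrices over k[p, y] as an algebra over k *)

Section PolynomialMatrices.
Variable k : comNzRingType.
Local Notation M := 'M[{poly {poly k}}]_2.

HB.instance Definition _ := GRing.NzRing.on (pmat k).

Definition pmat_scale (c : k) (a : pmat k) : pmat k := c%:P%:P *: (a : M).

Fact pmat_scaleA c d a : pmat_scale c (pmat_scale d a) = pmat_scale (c * d) a.
Proof. by rewrite /pmat_scale scalerA -!polyCM. Qed.
Fact pmat_scale1 : left_id 1 pmat_scale.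
Proof. by move=> a; rewrite /pmat_scale scale1r. Qed.
Fact pmat_scaleDr : right_distributive pmat_scale +%R.
Proof. by move=> c a b; rewrite /pmat_scale [LHS]scalerDr. Qed.
Fact pmat_scaleDl a : {morph pmat_scale^~ a : c d / c + d}.
Proof. by move=> c d; rewrite /pmat_scale !polyCD [LHS]scalerDl. Qed.

HB.instance Definition _ := GRing.Zmodule_isLmodule.Build k (pmat k)
  pmat_scaleA pmat_scale1 pmat_scaleDr pmat_scaleDl.

Fact pmat_scaleAl (c : k) (a b : pmat k) : c *: (a * b) = (c *: a) * b.
Proof. exact: (@scalerAl _ M c%:P%:P a b). Qed.
HB.instance Definition _ := GRing.Lmodule_isLalgebra.Build k (pmat k) pmat_scaleAl.

Fact pmat_scaleAr (c : k) (a b : pmat k) : c *: (a * b) = a * (c *: b).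
Proof. exact: (@scalerAr _ M c%:P%:P a b). Qed.
HB.instance Definition _ := GRing.Lalgebra_isAlgebra.Build k (pmat k) pmat_scaleAr.

Lemma mulmx22E (R : nzRingType) (a b : 'M[R]_2) i j :
  (a *m b) i j = a i 0 * b 0 j + a i 1 * b 1 j.
Proof.
rewrite mxE !big_ord_recl big_ord0 addr0.
by congr (_ + a i _ * b _ j); apply: val_inj.
Qed.

Lemma det_mx22 (R : comNzRingType) (a : 'M[R]_2) :
  \det a = a 0 0 * a 1 1 - a 0 1 * a 1 0.
Proof.
have e : lift 0 0 = 1 :> 'I_2 by apply: val_inj.
have e' : lift 1 0 = 0 :> 'I_2 by apply: val_inj.
rewrite (expand_det_row a 0) !big_ord_recl big_ord0 addr0 /cofactor !det_mx11 !mxE.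
by rewrite !e e' expr0 expr1 mul1r mulN1r mulrN.
Qed.

End PolynomialMatrices.

(** * Degree in p of the norm form *)

Section NormalFormSize.
Variable k : fieldType.
Hypothesis two_neq0 : 2%:R != 0 :> k.
Local Notation R := {poly {poly k}}.

(** The substitution y -> -y with p fixed; it arises because y x = 1 - x y changes the sign of y up
    to a constant. *)
Definition ybar : R -> R := map_poly (comp_poly (- 'X)).
HB.instance Definition _ := GRing.RMorphism.on ybar.

(** The scalar 2 y, which clears the denominator of the difference quotient (f(y) - f(-y)) / (2
    y). *)
Definition Y2 : R := ('X *+ 2)%:P.

Lemma ybarX : ybar 'X = 'X. Proof. exact: map_polyX. Qed.

Lemma ybarY : ybar 'X%:P = - 'X%:P.
Proof. by rewrite /ybar map_polyC /= comp_polyX polyCN. Qed.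

Lemma ybarC (c : k) : ybar c%:P%:P = c%:P%:P.
Proof. by rewrite /ybar map_polyC /= comp_polyC. Qed.

Lemma ybarK : involutive ybar.
Proof.
move=> f; rewrite /ybar -map_poly_comp /= map_poly_id // => h _ /=.
by rewrite -comp_polyA raddfN /= comp_polyX opprK comp_polyXr.
Qed.

Lemma size_ybar f : size (ybar f) = size f.
Proof.
apply/eqP; rewrite eqn_leq size_poly /=.
by rewrite -{1}(ybarK f) size_poly.
Qed.

Lemma Y2_neq0 : 'X *+ 2 != 0 :> {poly k}.
Proof.
by rewrite -scaler_nat scaler_eq0 (negbTE two_neq0) polyX_eq0.
Qed.

(* The degrees of [f * ybar f] and ['X * (g * ybar g)] have different parity, and
   the larger one exceeds that of the last two products. *)
Lemma size_norm_form (f g : R) :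
  size (Y2 * (f * ybar f - 'X * (g * ybar g)) + (g * ybar f - f * ybar g)) =
  maxn (2 * size f).-1 (2 * size g).
Proof.
have s1 : size (f * ybar f) = (2 * size f).-1.
  have [->|f0] := eqVneq f 0; first by rewrite mul0r size_poly0.
  rewrite size_mul ?size_ybar ?addnn ?mul2n //.
  by rewrite -size_poly_eq0 size_ybar size_poly_eq0.
have s2 : size (- ('X * (g * ybar g))) = (2 * size g)%N.
  have [->|g0] := eqVneq g 0; first by rewrite mul0r mulr0 oppr0 size_poly0.
  have g0' : ybar g != 0 by rewrite -size_poly_eq0 size_ybar size_poly_eq0.
  rewrite size_polyN mulrC size_mulX ?mulf_neq0 // size_mul // size_ybar.
  by move: g0; rewrite -size_poly_gt0; move: (size g); lia.
have s3 : (size (g * ybar f - f * ybar g)%R <= (size f + size g).-1)%N.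
  apply: leq_trans (size_polyD _ _) _; rewrite size_polyN geq_max.
  by rewrite !(leq_trans (size_polyMleq _ _)) ?size_ybar // addnC.
have s0 (h : R) : size (Y2 * h) = size h by rewrite /Y2 size_Cmul // Y2_neq0.
have [gf|fg] := ltnP (size g) (size f).
  have s4 : size (f * ybar f - 'X * (g * ybar g)) = (2 * size f).-1.
    by rewrite size_polyDl s1 // s2; lia.
  rewrite size_polyDl s0 s4; first by lia.
  by apply: leq_ltn_trans s3 _; lia.
(* Here [size f <= size g], so if g vanishes then so does f, and no summand dominates strictly. *)
have [g0|g0] := eqVneq (size g) 0%N.
  move: fg; rewrite g0 leqn0 size_poly_eq0 => /eqP ->.
  move/eqP: g0; rewrite size_poly_eq0 => /eqP ->.
  by rewrite !(mul0r, mulr0, raddf0, addr0, subr0, size_poly0).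
have s4 : size (f * ybar f - 'X * (g * ybar g)) = (2 * size g)%N.
  by rewrite addrC size_polyDl s2 // s1; lia.
rewrite size_polyDl s0 s4; first by lia.
by apply: leq_ltn_trans s3 _; lia.
Qed.

End NormalFormSize.

(** * The relation of W_2 and the central element x^2 *)

Section SkewWeylGenerators.
Variables (k : comNzRingType) (A : algType k) (u : 'I_2 -> A).
Hypothesis presA : presented_by u [:: W2_rel k].
Local Notation x := (u 0).
Local Notation y := (u 1).

Lemma W2_xy_eq : x * y + y * x = 1.
Proof.
apply/eqP; rewrite -subr_eq0 -freeEval_W2_rel; apply/eqP.
exact: (presented_rel presA (mem_head _ _)).
Qed.

Lemma W2_yx : y * x = 1 - x * y.
Proof. by rewrite -W2_xy_eq addrC addKr. Qed.

Lemma W2_ind (P : A -> Prop) :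
  P 1 -> (forall c a, P a -> P (c *: a)) ->
  (forall a b, P a -> P b -> P (a + b)) ->
  (forall a, P a -> P (x * a)) -> (forall a, P a -> P (y * a)) ->
  forall a, P a.
Proof.
move=> P1 PZ PD Px Py; apply: (presented_ind presA P1 PZ PD) => i a Pa.
case: i => [[|[|i]] lti] //.
- by rewrite (_ : Ordinal lti = 0); [apply: Px | apply: val_inj].
- by rewrite (_ : Ordinal lti = 1); [apply: Py | apply: val_inj].
Qed.

(** Against y the sign changes twice: y x^2 = x - x y x = x - x (1 - x y) = x^2 y. *)
Lemma W2_comm_x2 a : GRing.comm (x ^+ 2) a.
Proof.
elim/W2_ind: a => [|c a IH|a b IHa IHb|a IH|a IH].
- exact: commr1.
- by rewrite /GRing.comm -scalerAr IH scalerAl.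
- exact: commrD.
- by apply: commrM IH; apply/commr_sym/commrX.
apply: commrM IH; rewrite /GRing.comm.
by rewrite expr2 [RHS]mulrA W2_yx mulrBl mul1r -[_ * _ * x]mulrA W2_yx mulrBr
  mulr1 opprB addrC subrK mulrA.
Qed.

End SkewWeylGenerators.

(** * Left regular representation, norm and x-degree *)

Section SkewWeyl.
Variables (k : closedFieldType) (A : algType k) (u : 'I_2 -> A).
Hypothesis two_neq0 : 2%:R != 0 :> k.
Hypothesis presA : presented_by u [:: W2_rel k].
Local Notation x := (u 0).
Local Notation y := (u 1).
Local Notation R := {poly {poly k}}.

(** Left multiplication by x and by y on the right k[p, y]-module with basis 1, x. The columns hold
    the coordinates of x and x x = p in the first matrix, of y and y x = 1 - x y in the second. *)
Definition pmat_gen (i : 'I_2) : pmat k :=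
  if i == 0 then \matrix_(i, j) (if i == 0 then if j == 0 then 0 else 'X
                                 else (j == 0)%:R)
  else \matrix_(i, j) (if i == 0 then if j == 0 then 'X%:P else 1
                       else if j == 0 then 0 else - 'X%:P).

Lemma pmat_rel r : r \in [:: W2_rel k] -> freeEval pmat_gen r = 0.
Proof.
rewrite inE => /eqP ->; rewrite freeEval_W2_rel; apply/eqP.
rewrite subr_eq0; apply/eqP/matrixP => i j.
rewrite [LHS]mxE /GRing.mul /= !mulmx22E !mxE /=.
by case: i j => [[|[|i]] hi] [[|[|j]] hj] //=; ring.
Qed.

(** This exists by the relation alone, before W_2 is known to be free over k[p, y]. *)
Definition rho : {lrmorphism A -> pmat k} :=
  projT1 (cid (presented_lift presA pmat_rel)).

Lemma rho_gen i : rho (u i) = pmat_gen i.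
Proof. by rewrite /rho; case: cid => f /= ->. Qed.

Lemma rhoM a b i j :
  rho (a * b) i j = rho a i 0 * rho b 0 j + rho a i 1 * rho b 1 j.
Proof. by rewrite rmorphM; apply: mulmx22E. Qed.

Lemma commr_x2 : commr_rmorph (horner_alg y) (x ^+ 2).
Proof. by move=> h; apply: (W2_comm_x2 presA). Qed.

Definition iota : {rmorphism R -> A} := horner_morph commr_x2.

Lemma iotaX : iota 'X = x ^+ 2.
Proof. exact: horner_morphX. Qed.

Lemma iotaC h : iota h%:P = horner_alg y h.
Proof. exact: horner_morphC. Qed.

Lemma iotaY : iota 'X%:P = y.
Proof. by rewrite iotaC; apply: horner_algX. Qed.

Lemma iotaK c : iota c%:P%:P = c%:A.
Proof. by rewrite iotaC; apply: horner_algC. Qed.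

(** The first column of [rho a] holds the coordinates of a = a 1 in the basis 1, x, so left
    multiplication by a generator acts on both sides in the same way. *)
Lemma normal_form a : a = iota (rho a 0 0) + x * iota (rho a 1 0).
Proof.
elim/(W2_ind presA): a => [|c a IH|a b IHa IHb|a IH|a IH].
- by rewrite rmorph1 !mxE /= rmorph1 rmorph0 mulr0 addr0.
- rewrite {1}IH linearZ_LR /= !mxE !rmorphM /= !iotaK !mulr_algl.
  by rewrite scalerDr scalerAr.
- rewrite {1}IHa {1}IHb raddfD /= !mxE !raddfD mulrDr /= -!addrA.
  by congr (_ + _); rewrite addrCA.
- rewrite !rhoM !rho_gen {1}IH !mxE /= !mul0r !add0r !mul1r !addr0.
  by rewrite rmorphM /= iotaX mulrDr addrC mulrA -expr2.
rewrite !rhoM !rho_gen {1}IH !mxE /= !mul0r !add0r !mul1r.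
rewrite raddfD /= !rmorphM rmorphN /= iotaY.
by rewrite mulrDr mulrA (W2_yx presA) mulrBl mul1r -addrA mulNr mulrN mulrA.
Qed.

(* Twice [y] times the second column of [rho a], in terms of the first one; the
   difference quotient [(f - ybar f) / (2 y)] comes from [y * x = 1 - x * y]. *)
Lemma rho_col2 a :
  Y2 k * rho a 0 1 = rho a 0 0 - ybar (rho a 0 0) + Y2 k * 'X * ybar (rho a 1 0)
  /\ Y2 k * rho a 1 1 = Y2 k * ybar (rho a 0 0) + rho a 1 0 - ybar (rho a 1 0).
Proof.
have Y2E : Y2 k = 2%:R * 'X%:P by rewrite /Y2 raddfMn /= mulr_natl.
elim/(W2_ind presA): a => [|c a [IH1 IH2]|a b [a1 a2] [b1 b2]|a [IH1 IH2]|a [IH1 IH2]].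
- rewrite rmorph1 !mxE /= rmorph1 rmorph0; split; ring.
- rewrite linearZ_LR /= !mxE /= !rmorphM /= !ybarC.
  by rewrite ![Y2 k * (_ * _)]mulrCA IH1 IH2; split; ring.
- rewrite raddfD /= !mxE /= !rmorphD /= !(mulrDr (Y2 k)) a1 a2 b1 b2.
  by split; ring.
- rewrite !rhoM !rho_gen !mxE /= !mul0r !add0r !mul1r !addr0 rmorphM /= ybarX.
  by rewrite mulrCA IH1 IH2; split; ring.
rewrite !rhoM !rho_gen !mxE /= !mul0r !add0r !mul1r.
rewrite !(rmorphD, rmorphM, rmorphN) /= ybarY.
rewrite mulrDr [Y2 k * ('X%:P * _)]mulrCA [Y2 k * (- 'X%:P * _)]mulrCA IH1 IH2 Y2E.
by split; ring.
Qed.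

Definition rnorm a : R := \det (rho a : 'M_2).

Lemma rnormM a b : rnorm (a * b) = rnorm a * rnorm b.
Proof. by rewrite /rnorm rmorphM [LHS]det_mulmx. Qed.

(** Multiplication by 2 y does not change the degree in p, and by [rho_col2] it turns the
    determinant into the expression of [size_norm_form]. *)
Lemma size_rnorm a :
  size (rnorm a) = maxn (2 * size (rho a 0 0)).-1 (2 * size (rho a 1 0)).
Proof.
rewrite -size_norm_form // /rnorm det_mx22.
have [e1 e2] := rho_col2 a.
rewrite -[LHS](@size_Cmul _ ('X *+ 2)) ?Y2_neq0 // -/(Y2 k); congr (size (polyseq _)).
by rewrite mulrBr mulrCA e2 [Y2 k * (rho a 0 1 * _)]mulrA e1; ring.
Qed.

Lemma rnorm_eq0 a : (rnorm a == 0) = (a == 0).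
Proof.
apply/idP/idP => [|/eqP ->]; last first.
  by rewrite -size_poly_eq0 size_rnorm raddf0 !mxE size_poly0.
rewrite -size_poly_eq0 size_rnorm => n0.
rewrite [a]normal_form.
have /eqP -> : rho a 0 0 == 0 by rewrite -size_poly_eq0; move: n0; lia.
have /eqP -> : rho a 1 0 == 0 by rewrite -size_poly_eq0; move: n0; lia.
by rewrite rmorph0 mulr0 addr0.
Qed.

Lemma W2_domain (a b : A) : a * b = 0 -> a = 0 \/ b = 0.
Proof.
move=> ab; have: rnorm (a * b) == 0 by rewrite rnorm_eq0 ab.
by rewrite rnormM mulf_eq0 !rnorm_eq0 => /orP[] /eqP; [left|right].
Qed.

(** With a = f + x g and p = x^2, the degree of the norm in p is the degree of a in x. The truncated
    predecessor gives 0 the degree 0. *)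
Definition xdeg a := (size (rnorm a)).-1.

Lemma xdegM (a b : A) : a != 0 -> b != 0 -> xdeg (a * b) = (xdeg a + xdeg b)%N.
Proof.
rewrite -!rnorm_eq0 => a0 b0; rewrite /xdeg rnormM size_mul //.
by move: a0 b0; rewrite -!size_poly_gt0; move: (size _) (size _); lia.
Qed.

Lemma xdeg0P a : xdeg a = 0%N -> exists h, a = horner_alg y h.
Proof.
rewrite /xdeg size_rnorm => d0; rewrite [a]normal_form.
have /eqP -> : rho a 1 0 == 0 by rewrite -size_poly_eq0; move: d0; lia.
have /size1_polyC -> : (size (rho a 0 0)%R <= 1)%N by move: d0; lia.
by rewrite rmorph0 mulr0 addr0 iotaC; eexists.
Qed.

(** Over an algebraically closed field h splits into linear factors; each x - c has norm c^2 - p, of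
    degree 1 in p, and the degrees add. *)
Lemma xdeg_horner h : xdeg (horner_alg x h) = (size h).-1.
Proof.
have [->|h0] := eqVneq h 0.
  by rewrite raddf0 /xdeg size_rnorm raddf0 !mxE !size_poly0.
have xdZ (c : k) : c != 0 -> xdeg c%:A = 0%N.
  move=> c0; rewrite /xdeg size_rnorm linearZ_LR /= rmorph1 !mxE /= mulr0 mulr1.
  by rewrite size_poly0 size_polyC polyC_eq0 c0.
have A1 (c : k) : c != 0 -> c%:A != 0 :> A by rewrite scaler_eq0 oner_eq0 orbF.
have xB c : rnorm (x - c%:A) = (c ^+ 2)%:P%:P - 'X.
  rewrite /rnorm det_mx22 raddfB /= linearZ_LR /= rmorph1 rho_gen !mxE /=.
  by rewrite !rmorphXn /=; ring.
have xB0 c : x - c%:A != 0.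
  by rewrite -rnorm_eq0 xB -opprB oppr_eq0 polyXsubC_eq0.
have xdB c : xdeg (x - c%:A) = 1%N.
  by rewrite /xdeg xB -opprB size_polyN size_XsubC.
have [r ->] := closed_field_poly_normal h.
have l0 : lead_coef h != 0 by rewrite lead_coef_eq0.
rewrite size_scale // size_prod_XsubC /= -mul_polyC rmorphM /= horner_algC.
have [p0 pE] : horner_alg x (\prod_(z <- r) ('X - z%:P)) != 0 /\
    xdeg (horner_alg x (\prod_(z <- r) ('X - z%:P))) = size r.
  elim: r {h h0 l0} => [|c r [IH0 IH]].
    by rewrite big_nil rmorph1 oner_eq0 -(scale1r 1) xdZ ?oner_eq0.
  have cE : horner_alg x ('X - c%:P) = x - c%:A.
    by rewrite raddfB /= horner_algX horner_algC.
  rewrite big_cons rmorphM /= cE xdegM ?xB0 // IH xdB; split=> //.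
  by apply/eqP => /W2_domain[] /eqP; [apply/negP/xB0|apply/negP].
by rewrite xdegM ?A1 // xdZ // pE.
Qed.

End SkewWeyl.

(** * Degree computations and the element z *)

Section SkewWeylDegree.
Variables (k : closedFieldType) (A : algType k) (u : 'I_2 -> A).
Hypothesis two_neq0 : 2%:R != 0 :> k.
Hypothesis presA : presented_by u [:: W2_rel k].
Local Notation x := (u 0).
Local Notation y := (u 1).
Local Notation z := (x * y - y * x).
Local Notation rho := (rho presA).

Lemma xdeg_y : xdeg presA y = 0%N.
Proof.
rewrite /xdeg /rnorm det_mx22 rho_gen !mxE /= mulr0 subr0 mulrN -polyCM.
by rewrite size_polyN size_polyC; case: (_ != _).
Qed.

(** The norm is c^2 p y^2 + b^2 + b c, of degree at most 1 in p. *)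
Lemma xdeg_xy (b c : k) : (xdeg presA (c *: (x * y) + b%:A) <= 1)%N.
Proof.
rewrite /xdeg; have -> : rnorm presA (c *: (x * y) + b%:A) =
    'X * (c ^+ 2 *: 'X^2)%:P + (b ^+ 2 + b * c)%:P%:P.
  rewrite /rnorm det_mx22 raddfD /= !linearZ_LR /= rmorph1.
  rewrite !mxE /= !rhoM !rho_gen !mxE /= -mul_polyC !rmorphM rmorphD !rmorphM.
  by rewrite /=; ring.
rewrite mulrC size_MXaddC size_polyC.
by case: ifP => // _; case: (_ != _).
Qed.

(** Under [rho] the elements 1, x, y have first columns (1, 0), (0, 1), (y, 0). *)
Lemma W2_affine_indep (a b c : k) :
  a%:A + b *: x + c *: y = 0 -> [/\ a = 0, b = 0 & c = 0].
Proof.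
move=> /(congr1 rho); rewrite !raddfD /= !linearZ_LR /= rmorph1 !rho_gen raddf0.
move=> /matrixP r; move: (r 0 0) (r 1 0); rewrite !mxE /=.
rewrite !mulr0 !mulr1 !addr0 add0r -polyCM -polyCD => /eqP.
rewrite polyC_eq0 => /eqP /polyP ac /eqP; rewrite !polyC_eq0 => /eqP ->.
move: (ac 0%N) (ac 1%N).
by rewrite !coefD !coefMX !coefC /= addr0 add0r => -> ->.
Qed.

Lemma xdeg0 : xdeg presA 0 = 0%N.
Proof. by rewrite -[0](raddf0 (horner_alg x)) xdeg_horner // size_poly0. Qed.

Lemma W2_one_neq0 (c : k) : (c%:A == 0 :> A) = (c == 0).
Proof. by rewrite scaler_eq0 oner_eq0 orbF. Qed.

Lemma horner_alg_x_inj h : horner_alg x h = 0 -> h = 0.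
Proof.
move=> h0; have: (size h <= 1)%N.
  by rewrite -subn_eq0 subn1 -(xdeg_horner two_neq0 presA) h0 xdeg0.
move=> /size1_polyC hE; move: h0; rewrite hE /= horner_algC => /eqP.
by rewrite W2_one_neq0 => /eqP ->.
Qed.

Lemma W2_mulf_neq0 (a b : A) : a != 0 -> b != 0 -> a * b != 0.
Proof.
by move=> a0 b0; apply/eqP => /(W2_domain two_neq0 presA) [] /eqP; apply/negP.
Qed.

Lemma xdeg_x : xdeg presA x = 1%N.
Proof. by rewrite -(horner_algX x) xdeg_horner // size_polyX. Qed.

Lemma gen_x_neq0 : x != 0.
Proof. by apply: contraPneq xdeg_x => ->; rewrite xdeg0. Qed.

Lemma gen_y_neq0 : y != 0.
Proof.
apply/eqP => y0; have := W2_xy_eq presA; rewrite y0 mulr0 mul0r addr0 => /eqP.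
by rewrite eq_sym oner_eq0.
Qed.

Lemma x2_neq_y2 : x ^+ 2 - y ^+ 2 != 0.
Proof.
rewrite subr_eq0; apply: contraPneq (xdegM two_neq0 presA gen_x_neq0 gen_x_neq0).
rewrite -expr2 => ->; rewrite expr2 (xdegM two_neq0 presA) ?gen_y_neq0 //.
by rewrite xdeg_x xdeg_y.
Qed.

Lemma zE1 : z = 1 - (y * x) *+ 2.
Proof. by rewrite -(W2_xy_eq presA) mulr2n opprD addrA addrK. Qed.

Lemma zE2 : z = (x * y) *+ 2 - 1.
Proof. by rewrite -(W2_xy_eq presA) mulr2n opprD addrA addrK. Qed.

(** Writing z as 2 x y - 1 on the left and as 1 - 2 y x on the right reduces this to the centrality
    of x^2. *)
Lemma z_x : x * z = - (z * x).
Proof.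
apply/eqP; rewrite -addr_eq0 {1}zE2 zE1 mulrBr mulrBl mul1r mulr1 mulrnAl mulrnAr.
rewrite [x * (x * y)]mulrA -expr2 -[y * x * x]mulrA -expr2 (W2_comm_x2 presA).
by rewrite addrA subrK subrr.
Qed.

Lemma z_y : y * z = - (z * y).
Proof.
apply/eqP; rewrite -addr_eq0 {1}zE2 zE1 mulrBr mulrBl mul1r mulr1 mulrnAl mulrnAr.
by rewrite [y * (x * y)]mulrA addrA subrK subrr.
Qed.

(** The commutator with x is a derivation sending y to z, and z moves to the front past x and y at
    the cost of a sign. *)
Lemma commutator_x a : exists b, x * a - a * x = z * b.
Proof.
elim/(W2_ind presA): a => [|c a [b IH]|a a' [b IH] [b' IH']|a [b IH]|a [b IH]].
- by exists 0; rewrite mulr1 mul1r subrr mulr0.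
- by exists (c *: b); rewrite -scalerAr -scalerAl -scalerBr IH scalerAr.
- by exists (b + b'); rewrite !mulrDr -IH -IH' mulrDl opprD addrACA.
- by exists (- (x * b)); rewrite -mulrA -mulrBr IH mulrA z_x mulrN mulNr mulrA.
exists (a - y * b); rewrite mulrBr [z * (y * b)]mulrA -[z * y]opprK -z_y.
by rewrite mulNr opprK -[y * z * b]mulrA -IH mulrBr mulrBl !mulrA addrA subrK.
Qed.

(* [a = (z + 2 y x) a], and [2 x a] is the commutator of [x] and [a] *)
Lemma anticomm_dvd a : a * x = - (x * a) -> exists b, a = z * b.
Proof.
move=> ax; have [b] := commutator_x a; rewrite ax opprK => xab.
exists (a - y * b); rewrite mulrBr [z * (y * b)]mulrA -[z * y]opprK -z_y.
rewrite mulNr opprK -[y * z * b]mulrA -xab mulrDr !mulrA -mulr2n.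
by rewrite zE1 mulrBl mul1r mulrnAl subrK.
Qed.

End SkewWeylDegree.

(** * The swap, the y-degree and elements of low degree *)

Section SkewWeylSwap.
Variables (k : closedFieldType) (A : algType k) (u : 'I_2 -> A).
Hypothesis two_neq0 : 2%:R != 0 :> k.
Hypothesis presA : presented_by u [:: W2_rel k].
Local Notation x := (u 0).
Local Notation y := (u 1).
Local Notation z := (x * y - y * x).
Local Notation xdeg := (xdeg presA).
Variable s : algAut A.
Hypotheses (sx : s x = y) (sy : s y = x).

Lemma swapK a : s (s a) = a.
Proof.
elim/(W2_ind presA): a => [|c a IH|a b IHa IHb|a IH|a IH].
- by rewrite rmorph1 rmorph1.
- by rewrite linearZ_LR linearZ_LR /= IH.
- by rewrite raddfD raddfD /= IHa IHb.
- by rewrite rmorphM /= sx rmorphM /= sy IH.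
- by rewrite rmorphM /= sy rmorphM /= sx IH.
Qed.

Lemma swap_eq0 a : (s a == 0) = (a == 0).
Proof.
apply/eqP/eqP => [sa0|->]; last exact: raddf0.
by rewrite -[a]swapK sa0 raddf0.
Qed.

Definition ydeg a := xdeg (s a).

Lemma ydegM (a b : A) : a != 0 -> b != 0 -> ydeg (a * b) = (ydeg a + ydeg b)%N.
Proof. by move=> a0 b0; rewrite /ydeg rmorphM /= xdegM ?swap_eq0. Qed.

Lemma ydeg0P a : ydeg a = 0%N -> exists h, a = horner_alg x h.
Proof.
move=> /(xdeg0P two_neq0) [h sa]; exists h; rewrite -[a]swapK sa.
elim/poly_ind: h {sa} => [|h c IH]; first by rewrite !raddf0.
rewrite !rmorphD /= !rmorphM /= IH !horner_algX !horner_algC.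
by rewrite linearZ_LR /= rmorph1 sy.
Qed.

(** The vanishing y-degree makes a polynomial in x out of a, and its degree is [xdeg a]. *)
Lemma deg00 a : xdeg a = 0%N -> ydeg a = 0%N -> exists c, a = c%:A.
Proof.
move=> xa /ydeg0P [h aE]; move: xa; rewrite aE xdeg_horner // => sh.
have /size1_polyC -> : (size h <= 1)%N by rewrite -subn_eq0 subn1 sh.
by rewrite horner_algC; eexists.
Qed.

Lemma deg10 a : (xdeg a <= 1)%N -> ydeg a = 0%N -> exists b c, a = b%:A + c *: x.
Proof.
move=> xa /ydeg0P [h aE]; move: xa; rewrite aE xdeg_horner // => sh.
have hE : h = (h`_0)%:P + h`_1 *: 'X.
  apply/polyP => -[|[|i]]; rewrite coefD coefC coefZ coefX /=.
  - by rewrite mulr0 addr0.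
  - by rewrite mulr1 add0r.
  by rewrite mulr0 addr0 nth_default //; move: sh; case: (size h) => [|[|[|n]]].
exists h`_0, h`_1.
by rewrite {1}hE raddfD /= linearZ_LR /= horner_algC horner_algX mulr_algl.
Qed.

Lemma deg01 a : xdeg a = 0%N -> (ydeg a <= 1)%N -> exists b c, a = b%:A + c *: y.
Proof.
move=> xa ya; have [||b [c sa]] := @deg10 (s a) => //; first by rewrite /ydeg swapK.
exists b, c; rewrite -[a]swapK sa raddfD /= !linearZ_LR /= rmorph1.
by rewrite sx.
Qed.

Lemma W2_unit (a b : A) : a * b = 1 -> exists c, a = c%:A.
Proof.
move=> ab.
have a0 : a != 0 by apply/eqP => a0; move/eqP: ab; rewrite a0 mul0r eq_sym oner_eq0.
have b0 : b != 0 by apply/eqP => b0; move/eqP: ab; rewrite b0 mulr0 eq_sym oner_eq0.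
have d1 : xdeg 1 = 0%N.
  by rewrite -(rmorph1 (horner_alg x)) xdeg_horner // size_poly1.
have := xdegM two_neq0 presA a0 b0; have := ydegM a0 b0.
rewrite ab /ydeg rmorph1 d1 => e1 e2.
by apply: deg00; rewrite /ydeg; lia.
Qed.

(** Comparing degrees in x and y leaves x' = b + c x, and then x'^2 = x^2 fixes b and c. *)
Lemma x_normal_image (n x' : A) : n != 0 -> n * x = x' * n -> x' = x \/ x' = - x.
Proof.
move=> n0 nx; have x0 := gen_x_neq0 two_neq0 presA; have y0 := gen_y_neq0 presA.
have x'0 : x' != 0.
  apply/eqP => x'0; have := W2_mulf_neq0 two_neq0 presA n0 x0.
  by rewrite nx x'0 mul0r eqxx.
have := xdegM two_neq0 presA n0 x0; have := ydegM n0 x0.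
rewrite nx xdegM // ydegM // /ydeg sx xdeg_y xdeg_x // => e1 e2.
have [||b [c x'E]] := @deg10 x'; rewrite ?/ydeg; [lia|lia|].
(* Since x^2 is central, x'^2 n = n x^2 = x^2 n, and n cancels. *)
have x'2 : x' ^+ 2 = x ^+ 2.
  apply/eqP; rewrite -subr_eq0; apply/negPn/negP => d0.
  have := W2_mulf_neq0 two_neq0 presA d0 n0.
  rewrite mulrBl (W2_comm_x2 presA) !expr2 -mulrA -nx [x' * _]mulrA -nx -mulrA subrr.
  by rewrite eqxx.
have : horner_alg x ((b%:P + c *: 'X) ^+ 2 - 'X^2) = 0.
  rewrite raddfB /= !rmorphXn /= raddfD /= linearZ_LR /= horner_algC horner_algX.
  rewrite mulr_algl.
  by rewrite -x'E x'2 subrr.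
move=> /(horner_alg_x_inj two_neq0 presA) /polyP hE.
(* The coefficient of degree 2 gives c^2 = 1 and the constant one gives b^2 = 0. *)
have := hE 0%N; have := hE 2%N; rewrite !coefB !coefXn expr2 !coefM.
rewrite !big_ord_recl !big_ord0 /= !coefD !coefC !coefZ !coefX /=.
rewrite !(mulr0, mulr1, add0r, addr0, mul0r, subr0) => /eqP.
rewrite subr_eq0 -expr2 sqrf_eq1 => /orP[] /eqP cE /eqP;
  rewrite mulf_eq0 orbb => /eqP b0; move: x'E;
  rewrite b0 cE scale0r add0r ?scaleN1r ?scale1r; [by left|by right].
Qed.

Lemma y_normal_image (n y' : A) : n != 0 -> n * y = y' * n -> y' = y \/ y' = - y.
Proof.
move=> n0 ny; have [||e|e] := @x_normal_image (s n) (s y').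
- by rewrite swap_eq0.
- by rewrite -sy -!rmorphM /= ny.
- by left; rewrite -[y']swapK e sx.
- by right; rewrite -[y']swapK e raddfN /= sx.
Qed.

Lemma scalar_commutes (c : k) (b : A) : c%:A * b = b * c%:A.
Proof. by rewrite mulr_algl mulr_algr. Qed.

(** Once y x is replaced by 1 - x y, the products x y cancel; what remains is 2 a c + b d = 1, 2 b c
    = 0 and 2 a d = 0. *)
Lemma W2_pair_xy (a b c d : k) (X := a%:A + b *: x) (Y := c%:A + d *: y) :
  X * Y + Y * X = 1 -> b != 0 -> d != 0 -> [/\ a = 0, c = 0 & b * d = 1].
Proof.
move=> XY b0 d0.
have : (2%:R * (a * c) + b * d - 1)%:A + (2%:R * (b * c)) *: x +
    (2%:R * (a * d)) *: y = 0.
  rewrite -[RHS](subrr (1 : A)) -[X in _ = X - _]XY /X /Y.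
  rewrite !(mulrDl, mulrDr) -!scalerAl -!scalerAr !mul1r !mulr1 !scalerA.
  have -> : y * x = 1 - x * y by rewrite -(W2_xy_eq presA) addrC addKr.
  rewrite scalerBr !scalerDl scaleN1r (mulrC c a) (mulrC c b) (mulrC d a) (mulrC d b).
  (* The permutation groups the constants, then the multiples of x and of y, and puts the two
     opposite multiples of x y last. *)
  by rewrite !addrA [RHS](ACl (1*5*8*10*3*6*2*7*4*9)) /= addrK.
move=> /(W2_affine_indep presA) [e1 e2 e3].
have a0 : a = 0.
  by apply/eqP; move/eqP: e3; rewrite !mulf_eq0 (negbTE two_neq0) (negbTE d0) orbF.
have c0 : c = 0.
  by apply/eqP; move/eqP: e2; rewrite !mulf_eq0 (negbTE two_neq0) (negbTE b0).
split=> //; apply/eqP; by rewrite -subr_eq0 -e1 a0 mul0r mulr0 add0r.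
Qed.

(** If z = 0 then 2 y x = 1, so y is a unit and hence a scalar, against the independence of 1 and
    y. *)
Lemma gen_z_neq0 : z != 0.
Proof.
apply/eqP => z0; have : y * (2%:R *: x) = 1.
  rewrite -scalerAr scaler_nat; apply/eqP; rewrite eq_sym -subr_eq0.
  by rewrite -(zE1 presA) z0.
move=> /W2_unit [c yc].
have : (- c)%:A + 0 *: x + 1 *: y = 0.
  by rewrite yc scale0r addr0 scale1r -scalerDl addNr scale0r.
by move=> /(W2_affine_indep presA) [_ _ /eqP]; rewrite oner_eq0.
Qed.

Lemma swap_z : s z = - z.
Proof. by rewrite raddfB /= !rmorphM /= sx sy opprB. Qed.

Lemma xdeg_half (c : k) : (xdeg (2%:R^-1 *: (1 + c *: z)) <= 1)%N.
Proof.
have -> : 2%:R^-1 *: (1 + c *: z) = c *: (x * y) + (2%:R^-1 - 2%:R^-1 * c)%:A.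
  rewrite (zE2 presA) -scaler_nat scalerBr scalerA !scalerDr scalerN !scalerA.
  by rewrite scalerBl mulrCA mulVf // mulr1 addrCA.
exact: xdeg_xy.
Qed.

(* [X * Y = (1 + c z) / 2] has degree at most 1 in each of [x] and [y] *)
Lemma W2_pair (X Y : A) (c : k) :
  X * Y + Y * X = 1 -> X * Y - Y * X = c *: z -> c != 0 ->
  exists e f, e * f = 1 /\
    ((X = e *: x /\ Y = f *: y) \/ (X = e *: y /\ Y = f *: x)).
Proof.
move=> XY XYz c0.
have cz0 : c *: z != 0 by rewrite scaler_eq0 (negbTE c0) gen_z_neq0.
have X0 : X != 0 by apply: contraNneq cz0 => X0; rewrite -XYz X0 mul0r mulr0 subrr.
have Y0 : Y != 0 by apply: contraNneq cz0 => Y0; rewrite -XYz Y0 mul0r mulr0 subrr.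
(* A scalar commutes with everything, whereas the commutator of X and Y is the nonzero element c
   z. *)
have Xs : ~ exists e, X = e%:A.
  by move=> [e Xe]; move/eqP: cz0; rewrite -XYz Xe scalar_commutes subrr.
have Ys : ~ exists e, Y = e%:A.
  by move=> [e Ye]; move/eqP: cz0; rewrite -XYz Ye scalar_commutes subrr.
have XYE : X * Y = 2%:R^-1 *: (1 + c *: z).
  rewrite -XYz -XY addrACA subrr addr0 -mulr2n -scaler_nat scalerA.
  by rewrite mulVf // scale1r.
have sXYE : s (X * Y) = 2%:R^-1 *: (1 + (- c) *: z).
  by rewrite XYE linearZ_LR raddfD /= linearZ_LR /= rmorph1 swap_z scalerN scaleNr.
have := xdeg_half c; rewrite -XYE xdegM // => d1.
have := xdeg_half (- c); rewrite -sXYE -/(ydeg _) ydegM // => d2.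
have X00 : (xdeg X + ydeg X != 0)%N.
  by apply/eqP => d0; apply: Xs; apply: deg00; move: d0; lia.
have Y00 : (xdeg Y + ydeg Y != 0)%N.
  by apply/eqP => d0; apply: Ys; apply: deg00; move: d0; lia.
(* The x-degrees of X and Y sum to at most 1, so do the y-degrees, and neither element has both
   degrees 0: one has degrees (1, 0), the other (0, 1). *)
have [dX|dX] := eqVneq (ydeg X) 0%N.
  have [||b [e XE]] := @deg10 X; [lia|lia|].
  have [||b' [f YE]] := @deg01 Y; [lia|lia|].
  have e0 : e != 0.
    by apply/eqP => e0; apply: Xs; exists b; rewrite XE e0 scale0r addr0.
  have f0 : f != 0.
    by apply/eqP => f0; apply: Ys; exists b'; rewrite YE f0 scale0r addr0.
  have [|b0 b'0 ef] := @W2_pair_xy b e b' f _ e0 f0; first by rewrite -XE -YE.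
  exists e, f; split=> //; left.
  by rewrite XE YE b0 b'0 !scale0r !add0r.
have [||b [e XE]] := @deg01 X; [lia|lia|].
have [||b' [f YE]] := @deg10 Y; [lia|lia|].
have e0 : e != 0.
  by apply/eqP => e0; apply: Xs; exists b; rewrite XE e0 scale0r addr0.
have f0 : f != 0.
  by apply/eqP => f0; apply: Ys; exists b'; rewrite YE f0 scale0r addr0.
have [|b'0 b0 fe] := @W2_pair_xy b' f b e _ f0 e0; first by rewrite -XE -YE addrC.
exists e, f; split; first by rewrite mulrC.
by right; rewrite XE YE b0 b'0 !scale0r !add0r.
Qed.

End SkewWeylSwap.

(** * Ore extensions *)

Section OreCoefficients.
Variables (k : comNzRingType) (A : algType k) (s : algAut A).
Implicit Types p q : ore s.

Lemma coef_oreM p q n :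
  ((p * q : ore s) : {poly A})`_n =
  \sum_(i < n.+1) (p : {poly A})`_i * (s ^+ i)%g (q : {poly A})`_(n - i).
Proof.
pose N := maxn (size (p : {poly A})) n.+1.
rewrite -[LHS]/((ore_mul s p q)`_n) (@ore_mulE _ _ _ N) ?leq_maxl // coef_sum.
rewrite [RHS](big_ord_widen N (fun i => (p : {poly A})`_i *
  (s ^+ i)%g (q : {poly A})`_(n - i))) ?leq_maxr // [RHS]big_mkcond.
apply: eq_bigr => i _; rewrite coefZ coefMXn ltnS ltnNge.
by case: leqP => _ /=; rewrite ?mulr0 // coef_map.
Qed.

Lemma coef0_oreM p q :
  ((p * q : ore s) : {poly A})`_0 = (p : {poly A})`_0 * (q : {poly A})`_0.
Proof. by rewrite coef_oreM big_ord1 expg0. Qed.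

Lemma coef_ore_injM a p n :
  ((ore_inj s a * p : ore s) : {poly A})`_n = a * (p : {poly A})`_n.
Proof.
rewrite coef_oreM big_ord_recl coefC expg0 subn0 big1 ?addr0 // => i _.
by rewrite coefC mul0r.
Qed.

Lemma coef_oreM_inj a p n :
  ((p * ore_inj s a : ore s) : {poly A})`_n = (p : {poly A})`_n * (s ^+ n)%g a.
Proof.
rewrite coef_oreM big_ord_recr big1 /= => [|i _]; first by rewrite add0r subnn coefC.
by rewrite coefC subn_eq0 leqNgt ltn_ord raddf0 mulr0.
Qed.

Lemma coef_oreMt p n : ((p * ore_t s : ore s) : {poly A})`_n =
  if n is n'.+1 then (p : {poly A})`_n' else 0.
Proof.
rewrite coef_oreM; case: n => [|n].
  by rewrite big_ord1 coefX raddf0 mulr0.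
rewrite !big_ord_recr /= subnn subSnn !coefX /= rmorph1 mulr1 raddf0 mulr0 addr0.
rewrite big1 ?add0r // => i _; rewrite coefX.
have /negPf -> : (n.+1 - i != 1)%N by have := ltn_ord i; lia.
by rewrite raddf0 mulr0.
Qed.

Lemma coef_oretM p n : ((ore_t s * p : ore s) : {poly A})`_n =
  if n is n'.+1 then s (p : {poly A})`_n' else 0.
Proof.
rewrite coef_oreM; case: n => [|n].
  by rewrite big_ord1 coefX mul0r.
rewrite !big_ord_recl /= !coefX /= mul0r add0r mul1r subSS subn0 expg1.
by rewrite big1 ?addr0 // => i _; rewrite coefX mul0r.
Qed.

(** The quotient shifts the coefficients down by one; a right factor t does not twist them by s. *)
Lemma coef0_eq0 p : (p : {poly A})`_0 = 0 -> exists q, p = q * ore_t s.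
Proof.
move=> p0; exists (\poly_(i < size (p : {poly A})) (p : {poly A})`_i.+1 : {poly A}).
apply/polyP => -[|n]; rewrite coef_oreMt // coef_poly.
by case: ltnP => // pn; rewrite nth_default // leqW.
Qed.

Lemma size_ore1 p : (size (p : {poly A}) <= 1)%N -> p = ore_inj s (p : {poly A})`_0.
Proof. exact: size1_polyC. Qed.

Lemma algAut_eq0 (r : algAut A) a : (r a == 0) = (a == 0).
Proof. by rewrite -[X in _ == X](raddf0 r) (inj_eq (bij_inj (aut_bij r))). Qed.

Section Domain.
Hypothesis domA : forall a b : A, a * b = 0 -> a = 0 \/ b = 0.

Lemma algebra_mulf_neq0 (a b : A) : a != 0 -> b != 0 -> a * b != 0.
Proof. by move=> a0 b0; apply/eqP => /domA[] /eqP; apply/negP. Qed.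

Lemma ore_lead p q m n :
  size (p : {poly A}) = m.+1 -> size (q : {poly A}) = n.+1 ->
  ((p * q : ore s) : {poly A})`_(m + n) =
  (p : {poly A})`_m * (s ^+ m)%g (q : {poly A})`_n.
Proof.
move=> sp sq; rewrite coef_oreM (bigD1 (inord m)) //= inordK ?ltnS ?leq_addr //.
rewrite addKn big1 ?addr0 // => i im.
have [mi|im'|mi] := ltngtP m i.
- by rewrite nth_default ?mul0r // sp.
- by rewrite [q`_ _]nth_default ?raddf0 ?mulr0 // sq; lia.
by case/negP: im; apply/eqP/val_inj; rewrite /= inordK ?ltnS ?leq_addr.
Qed.

(** The top coefficient of the product is p_m s^m(q_n), which is nonzero because A is a domain and s
    is injective. *)
Lemma size_oreM p q : p != 0 -> q != 0 ->
  size ((p * q : ore s) : {poly A}) =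
  (size (p : {poly A}) + size (q : {poly A})).-1.
Proof.
rewrite -!size_poly_gt0; case sp: (size (p : {poly A})) => [|m] // _.
case sq: (size (q : {poly A})) => [|n] // _; rewrite addSn addnS /=.
apply/eqP; rewrite eqn_leq; apply/andP; split.
  apply/leq_sizeP => j mj; rewrite coef_oreM big1 // => i _.
  have [mi|im] := ltnP m i; first by rewrite nth_default ?mul0r // sp.
  by rewrite [q`_ _]nth_default ?raddf0 ?mulr0 // sq; lia.
rewrite ltnNge; apply/negP => /leq_sizeP /(_ _ (leqnn _)) /eqP.
rewrite (ore_lead sp sq); apply/negP; apply: algebra_mulf_neq0.
  by rewrite -[m]/(m.+1.-1) -sp -lead_coefE lead_coef_eq0 -size_poly_eq0 sp.
rewrite algAut_eq0.
by rewrite -[n]/(n.+1.-1) -sq -lead_coefE lead_coef_eq0 -size_poly_eq0 sq.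
Qed.

Lemma ore_mulf_neq0 p q : p != 0 -> q != 0 -> p * q != 0.
Proof.
move=> p0 q0; rewrite -size_poly_gt0 size_oreM //.
move: p0 q0; rewrite -!size_poly_gt0.
by case: (size _) => // m; case: (size _) => // n; rewrite addnS.
Qed.

End Domain.
End OreCoefficients.

(** * Evaluation of Ore polynomials *)

Section OreHorner.
Variables (k : comNzRingType) (A B : algType k) (s : algAut A).
Variables (g : {lrmorphism A -> B}) (b : B).
Hypothesis bg : forall a, b * g a = g (s a) * b.

Lemma ore_mul_polyX (p : {poly A}) : p * 'X = (p : ore s) * ore_t s :> ore s.
Proof. by apply/polyP => -[|n]; rewrite coef_oreMt // coefMX. Qed.

Lemma ore_tM_poly (p : ore s) : ore_t s * p = map_poly s p * 'X :> {poly A}.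
Proof. by apply/polyP => -[|n]; rewrite coef_oretM coefMX // coef_map. Qed.

Lemma ore_injM_poly a (p : ore s) : ore_inj s a * p = a *: (p : {poly A}) :> {poly A}.
Proof. by apply/polyP => n; rewrite coef_ore_injM coefZ. Qed.

(** Ordinary evaluation at [b] with the coefficients on the left. Words grow by left multiplication,
    so the presentation of S rests on compatibility with left factors from A and with t. *)
Definition ore_horner (p : ore s) : B := (map_poly g (p : {poly A})).[b].

Lemma ore_hornerD p q : ore_horner (p + q) = ore_horner p + ore_horner q.
Proof.
by rewrite /ore_horner -hornerD; congr (_.[b]); exact: raddfD.
Qed.

Lemma ore_horner_injM a p : ore_horner (ore_inj s a * p) = g a * ore_horner p.
Proof. by rewrite /ore_horner ore_injM_poly map_polyZ hornerZ. Qed.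

Lemma ore_horner1 : ore_horner 1 = 1.
Proof. by rewrite /ore_horner rmorph1 hornerC. Qed.

(** By [bg], moving [b] past a coefficient applies s to it, exactly as t does in A[t; s]. *)
Lemma ore_horner_tM p : ore_horner (ore_t s * p) = b * ore_horner p.
Proof.
rewrite /ore_horner ore_tM_poly rmorphM /= map_polyX hornerMX.
elim/poly_ind: p => [|p a IH]; first by rewrite !raddf0 !horner0 mulr0 mul0r.
rewrite !rmorphD !rmorphM /= !map_polyX !map_polyC /= !hornerD !hornerMX !hornerC.
by rewrite mulrDr mulrDl bg mulrA IH.
Qed.

Lemma ore_hornerZ c p : ore_horner (c *: p) = c *: ore_horner p.
Proof.
have -> : c *: p = ore_inj s c%:A * p by rewrite linearZ_LR /= rmorph1 mulr_algl.
by rewrite ore_horner_injM linearZ_LR /= rmorph1 mulr_algl.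
Qed.

End OreHorner.

(** * Generators and relations of the swap extension *)

Section SwapOrePresentation.
Variables (k : comNzRingType) (A : algType k) (u : 'I_2 -> A) (s : algAut A).
Hypothesis presA : presented_by u [:: W2_rel k].
Hypotheses (sx : s (u 0) = u 1) (sy : s (u 1) = u 0).

Lemma in_seq3 (T : eqType) (P : T -> Prop) (a b c : T) :
  (forall r, r \in [:: a; b; c] -> P r) <-> [/\ P a, P b & P c].
Proof.
split=> [Pr|[Pa Pb Pc] r]; first by split; apply: Pr; rewrite !inE eqxx ?orbT.
by rewrite !inE => /or3P[] /eqP ->.
Qed.

Lemma freeEvalM (n : nat) (B : algType k) (v : 'I_n -> B) p q :
  freeEval v (p * q) = freeEval v p * freeEval v q.
Proof. exact: rmorphM. Qed.

Lemma S_rels_eval (B : algType k) (v : 'I_3 -> B) :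
  (forall r, r \in S_rels k -> freeEval v r = 0) <->
  [/\ v 0 * v 1 + v 1 * v 0 = 1, v 2 * v 0 = v 1 * v 2 & v 2 * v 1 = v 0 * v 2].
Proof.
have eM i j : freeEval v (freeX k i * freeX k j) = v i * v j.
  by rewrite (freeEvalM v (freeX k i) (freeX k j)) !freeEvalX.
have eB p q : freeEval v (p - q) = freeEval v p - freeEval v q by exact: raddfB.
have eD p q : freeEval v (p + q) = freeEval v p + freeEval v q by exact: raddfD.
have e1 : freeEval v (freeX k 0 * freeX k 1 + freeX k 1 * freeX k 0 - 1)
    = v 0 * v 1 + v 1 * v 0 - 1.
  etransitivity; first exact: eB.
  congr (_ - _); last exact: rmorph1.
  by etransitivity; [exact: eD|congr (_ + _); exact: eM].
have e2 : freeEval v (freeX k 2 * freeX k 0 - freeX k 1 * freeX k 2)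
    = v 2 * v 0 - v 1 * v 2.
  by etransitivity; [exact: eB|congr (_ - _); exact: eM].
have e3 : freeEval v (freeX k 2 * freeX k 1 - freeX k 0 * freeX k 2)
    = v 2 * v 1 - v 0 * v 2.
  by etransitivity; [exact: eB|congr (_ - _); exact: eM].
apply: (iff_trans (in_seq3 _ _ _ _)).
split=> -[v1 v2 v3]; split.
- by apply: subr0_eq; apply: etrans (esym e1) v1.
- by apply: subr0_eq; apply: etrans (esym e2) v2.
- by apply: subr0_eq; apply: etrans (esym e3) v3.
- by apply: etrans e1 _; rewrite v1 subrr.
- by apply: etrans e2 _; rewrite v2 subrr.
- by apply: etrans e3 _; rewrite v3 subrr.
Qed.

Definition swap_ore_gen : 'I_3 -> ore s :=
  tnth [tuple ore_inj s (u 0); ore_inj s (u 1); ore_t s].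

Lemma swap_ore_rel r : r \in S_rels k -> freeEval swap_ore_gen r = 0.
Proof.
move: r; apply/S_rels_eval; split; last 2 first.
- by rewrite [LHS]ore_tM sx.
- by rewrite [LHS]ore_tM sy.
transitivity (ore_inj s (u 0 * u 1 + u 1 * u 0)); last by rewrite W2_xy_eq // rmorph1.
by rewrite rmorphD /= !rmorphM.
Qed.

Lemma swap_intertwine (B : algType k) (g : {lrmorphism A -> B}) (b : B) :
  b * g (u 0) = g (u 1) * b -> b * g (u 1) = g (u 0) * b ->
  forall a, b * g a = g (s a) * b.
Proof.
move=> bx by_; elim/(W2_ind presA) => [|c a IH|a a' IHa IHa'|a IH|a IH].
- by rewrite !rmorph1 mulr1 mul1r.
- by rewrite [s _]linearZ_LR !linearZ_LR /= -scalerAr IH scalerAl.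
- by rewrite [s _]raddfD !raddfD /= mulrDr IHa IHa' mulrDl.
- by rewrite [s _]rmorphM /= !rmorphM /= sx mulrA bx -mulrA IH mulrA.
- by rewrite [s _]rmorphM /= !rmorphM /= sy mulrA by_ -mulrA IH mulrA.
Qed.

(** Evaluation at [v] factors through S, so whatever vanishes in S also vanishes at [v]. *)
Lemma ore_horner_freeEval (B : algType k) (v : 'I_3 -> B) (g : {lrmorphism A -> B}) :
  g (u 0) = v 0 -> g (u 1) = v 1 ->
  v 2 * v 0 = v 1 * v 2 -> v 2 * v 1 = v 0 * v 2 ->
  forall p, ore_horner g (v 2) (freeEval swap_ore_gen p) = freeEval v p.
Proof.
move=> gx gy v2 v3; have vg := @swap_intertwine _ g (v 2).
rewrite gx gy in vg; move: {vg}(vg v2 v3) => vg.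
elim/freeAlg_ind => [|c p IH|p q IHp IHq|i p IH].
- by rewrite !rmorph1 ore_horner1.
- by rewrite !linearZ_LR /= ore_hornerZ IH.
- by rewrite !raddfD /= ore_hornerD IHp IHq.
rewrite !freeEvalM !freeEvalX -IH.
case: i => [[|[|[|i]]] lti] //.
- by rewrite [swap_ore_gen _]/= ore_horner_injM gx; congr (v _ * _); apply: val_inj.
- by rewrite [swap_ore_gen _]/= ore_horner_injM gy; congr (v _ * _); apply: val_inj.
by rewrite [swap_ore_gen _]/= ore_horner_tM //; congr (v _ * _); apply: val_inj.
Qed.

(** To bound the kernel, [v] is taken to be the classes of the generators modulo the ideal of
    relations. Evaluation at [v] is then the quotient map, and it factors through S. *)
Lemma swap_ore_presented : presented_by swap_ore_gen (S_rels k).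
Proof.
split=> [|p]; last split=> [|]; last exact: ideal_gen_ker swap_ore_rel p.
  have inj a : exists p, freeEval swap_ore_gen p = ore_inj s a.
    elim/(W2_ind presA): a => [|c a [p IH]|a b [p IHa] [q IHb]|a [p IH]|a [p IH]].
    - by exists 1; rewrite !rmorph1.
    - by exists (c *: p); rewrite !linearZ_LR /= IH.
    - by exists (p + q); rewrite !rmorphD /= IHa IHb.
    - by exists (freeX k 0 * p); rewrite freeEvalM IH freeEvalX -rmorphM.
    - by exists (freeX k 1 * p); rewrite freeEvalM IH freeEvalX -rmorphM.
  elim/poly_ind => [|q a [p IH]]; first by exists 0; rewrite raddf0.
  have [r ra] := inj a; exists (p * freeX k 2 + r).
  by rewrite raddfD /= freeEvalM freeEvalX IH ra (ore_mul_polyX s).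
(* The quotient algebra is formed by a proper ideal; this one is proper because its evaluation in S
   vanishes and that of 1 does not. *)
have J1 : ~ ideal_gen (S_rels k) 1.
  move/(ideal_gen_ker swap_ore_rel) => /eqP; rewrite rmorph1; apply/negP.
  exact: oner_neq0.
pose J := Defs.ProperIdeal (ideal_gen_ideal (S_rels k)) J1.
pose v i := quot_pi J (freeX k i).
have [v1 v2 v3] : [/\ v 0 * v 1 + v 1 * v 0 = 1, v 2 * v 0 = v 1 * v 2
    & v 2 * v 1 = v 0 * v 2].
  apply/S_rels_eval => r rr; rewrite freeEval_pi.
  by apply/quot_pi_eq0; apply: ideal_gen_rel.
pose w i := v (widen_ord (leqnSn 2) i).
have w0 : w 0 = v 0 by congr (quot_pi J (freeX k _)); apply: val_inj.
have w1 : w 1 = v 1 by congr (quot_pi J (freeX k _)); apply: val_inj.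
have [|g gE] := presented_lift presA (v := w).
  move=> r; rewrite inE => /eqP ->; rewrite freeEval_W2_rel; apply/eqP.
  by rewrite subr_eq0 w0 w1 v1.
have GE := ore_horner_freeEval (etrans (gE 0) w0) (etrans (gE 1) w1) v2 v3 p.
move=> p0; apply/(quot_pi_eq0 J); rewrite -freeEval_pi.
apply: etrans (esym GE) _; rewrite p0.
by rewrite /ore_horner raddf0 horner0.
Qed.

End SwapOrePresentation.

(** * Automorphisms of S *)

Section SwapOreAutomorphisms.
Variables (k : closedFieldType) (A : algType k) (u : 'I_2 -> A) (s : algAut A).
Hypothesis two_neq0 : 2%:R != 0 :> k.
Hypothesis presA : presented_by u [:: W2_rel k].
Hypotheses (sx : s (u 0) = u 1) (sy : s (u 1) = u 0).
Local Notation x := (u 0).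
Local Notation y := (u 1).
Local Notation z := (x * y - y * x).
Local Notation S := (ore s).
Local Notation inj := (ore_inj s).
Local Notation X := (inj x).
Local Notation Y := (inj y).
Local Notation T := (ore_t s).
Local Notation cf p i := ((p : {poly A})`_i).
Local Notation sz p := (size (p : {poly A})).

Let domA := W2_domain two_neq0 presA.
Let presS := swap_ore_presented presA sx sy.

Lemma sizeM (a b : S) : a != 0 -> b != 0 -> sz (a * b) = (sz a + sz b).-1.
Proof. exact: size_oreM. Qed.

Lemma size1E (a : S) : (sz a <= 1)%N -> a = inj (cf a 0).
Proof. exact: size_ore1. Qed.

Lemma ore_XY : X * Y + Y * X = 1.
Proof. by rewrite -!rmorphM -raddfD /= W2_xy_eq // rmorph1. Qed.

Lemma ore_TX : T * X = Y * T. Proof. by rewrite ore_tM sx. Qed.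

Lemma ore_TY : T * Y = X * T. Proof. by rewrite ore_tM sy. Qed.

Lemma swap_ore_ind (P : S -> Prop) :
  P 1 -> (forall c a, P a -> P (c *: a)) ->
  (forall a b, P a -> P b -> P (a + b)) ->
  (forall a, P a -> P (X * a)) -> (forall a, P a -> P (Y * a)) ->
  (forall a, P a -> P (T * a)) -> forall a, P a.
Proof.
move=> P1 PZ PD PX PY PT; apply: (presented_ind presS P1 PZ PD) => i a Pa.
by case: i => [[|[|[|i]]] lti] //; [apply: PX|apply: PY|apply: PT].
Qed.

(** Sizes add, so a and b lie in W_2, where the units are scalars. *)
Lemma ore_unit (a b : S) : a * b = 1 -> exists c, b = c%:A.
Proof.
move=> ab.
have a0 : a != 0 by apply/eqP => a0; move/eqP: ab; rewrite a0 mul0r eq_sym oner_eq0.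
have b0 : b != 0 by apply/eqP => b0; move/eqP: ab; rewrite b0 mulr0 eq_sym oner_eq0.
have sab : (sz a + sz b).-1 = 1%N by rewrite -sizeM // ab size_poly1.
have sa : (0 < sz a)%N by rewrite size_poly_gt0.
have sb : (0 < sz b)%N by rewrite size_poly_gt0.
have aE : a = inj (cf a 0) by apply: size1E; lia.
have bE : b = inj (cf b 0) by apply: size1E; lia.
have /(W2_unit two_neq0 presA sx sy) [c ac] : cf a 0 * cf b 0 = 1.
  by rewrite -coef0_oreM ab coefC.
have cb : c *: b = 1 by rewrite -ab aE ac linearZ_LR /= rmorph1 mulr_algl.
have c0 : c != 0.
  by apply/eqP => c0; move/eqP: cb; rewrite c0 scale0r eq_sym oner_eq0.
by exists c^-1; rewrite -cb scalerA mulVf // scale1r.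
Qed.

Lemma autVK (f : algAut S) a : f ((f^-1)%g a) = a.
Proof. by rewrite -[RHS]/((1%g : algAut S) a) -(mulgV f). Qed.

Lemma autKV (f : algAut S) a : (f^-1)%g (f a) = a.
Proof. by rewrite -[RHS]/((1%g : algAut S) a) -(mulVg f). Qed.

(** * Normal elements *)

Definition normal (n : S) := forall a, exists a', n * a = a' * n.

Lemma aut_normal (f : algAut S) n : normal n -> normal (f n).
Proof.
move=> nn a; have [a' na] := nn ((f^-1)%g a); exists (f a').
by rewrite -rmorphM -na rmorphM /= autVK.
Qed.

Lemma normal_gens (n x' y' t' : S) :
  n * X = x' * n -> n * Y = y' * n -> n * T = t' * n -> normal n.
Proof.
move=> nx ny nt; elim/swap_ore_ind
  => [|c a [a' IH]|a b [a' IHa] [b' IHb]|a [a' IH]|a [a' IH]|a [a' IH]].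
- by exists 1; rewrite mulr1 mul1r.
- by exists (c *: a'); rewrite -scalerAr IH scalerAl.
- by exists (a' + b'); rewrite mulrDr IHa IHb mulrDl.
- by exists (x' * a'); rewrite mulrA nx -!mulrA IH.
- by exists (y' * a'); rewrite mulrA ny -!mulrA IH.
- by exists (t' * a'); rewrite mulrA nt -!mulrA IH.
Qed.

Lemma normal_T : normal T.
Proof. exact: (normal_gens ore_TX ore_TY (erefl (T * T))). Qed.

Lemma ore_z_T : inj z * T = - T * inj z.
Proof. by rewrite mulNr ore_tM (swap_z sx sy) raddfN /= mulNr opprK. Qed.

Lemma normal_z : normal (inj z).
Proof.
apply: (@normal_gens _ (- X) (- Y) (- T)); last exact: ore_z_T.
- by rewrite mulNr -!rmorphM /= z_x // raddfN opprK.
- by rewrite mulNr -!rmorphM /= z_y // raddfN opprK.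
Qed.

(** If n x = x' n, then the sizes put x' in W_2, and the constant coefficients satisfy n_0 x = x'
    n_0 with n_0 nonzero, so [x_normal_image] applies; likewise for y. *)
Lemma normal_gens_image n : normal n -> cf n 0 != 0 ->
  (n * X = X * n \/ n * X = - (X * n)) /\ (n * Y = Y * n \/ n * Y = - (Y * n)).
Proof.
move=> nn n0.
have nz : n != 0 by apply: contraNneq n0 => ->; rewrite coef0.
have step a a' : a != 0 -> n * inj a = a' * n -> a' = inj (cf a' 0).
  move=> a0 na; apply: size1E.
  have ia0 : inj a != 0 by rewrite -size_poly_gt0 size_polyC a0.
  have a'0 : a' != 0.
    apply/eqP => a'0; have := ore_mulf_neq0 domA nz ia0.
    by rewrite na a'0 mul0r eqxx.
  have sa : sz (inj a) = 1%N by rewrite size_polyC a0.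
  have sn : (0 < sz n)%N by rewrite size_poly_gt0.
  have := sizeM nz ia0; rewrite na sizeM // sa; lia.
have coef a a' : n * inj a = a' * n -> cf n 0 * a = cf a' 0 * cf n 0.
  by move=> /(congr1 (fun p => cf p 0)); rewrite !coef0_oreM coefC.
split.
  have [x' nx] := nn X; have := step _ _ (gen_x_neq0 two_neq0 presA) nx.
  have [->|->] := x_normal_image two_neq0 presA sx sy n0 (coef _ _ nx) => xE.
    by left; rewrite nx xE.
  by right; rewrite nx xE raddfN mulNr.
have [y' ny] := nn Y; have := step _ _ (gen_y_neq0 presA) ny.
have [->|->] := y_normal_image two_neq0 presA sx sy n0 (coef _ _ ny) => yE.
  by left; rewrite ny yE.
by right; rewrite ny yE raddfN mulNr.
Qed.

(** * The image of t under an automorphism *)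

Lemma coef0_T n : cf (n * T) 0 = 0.
Proof. by rewrite coef_oreMt. Qed.

Lemma ore_TI (a b : S) : a * T = b * T -> a = b.
Proof.
move=> /eqP; rewrite -subr_eq0 -mulrBl => ab; apply/eqP; rewrite -subr_eq0.
apply: contraTT ab => ab; apply: (ore_mulf_neq0 domA ab).
by rewrite -size_poly_gt0 size_polyX.
Qed.

Lemma chi_exists : exists (r : k) (chi : {lrmorphism S -> {poly k}}),
  [/\ r != 0, chi X = r%:P, chi Y = r%:P & chi T = 'X].
Proof.
(* The equation solved is r^2 = 1/2, so that sending x and y to r respects x y + y x = 1. *)
have [r r2] := @solve_monicpoly k 2 (fun i => if i == 0%N then 2%:R^-1 else 0) isT.
rewrite !big_ord_recl big_ord0 /= expr0 mulr1 mul0r !addr0 in r2.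
have r0 : r != 0.
  apply/eqP => r0; move/eqP: r2; rewrite r0 expr0n /= eq_sym invr_eq0.
  by rewrite (negbTE two_neq0).
pose v := tnth [tuple r%:P; r%:P; 'X : {poly k}].
have [v0 v1 v2] : [/\ v 0 = r%:P, v 1 = r%:P & v 2 = 'X] by [].
have vrels : forall i, i \in S_rels k -> freeEval v i = 0.
  apply: (proj2 (S_rels_eval v)); rewrite v0 v1 v2; split; last 2 first.
  - exact: mulrC.
  - exact: mulrC.
  by rewrite -polyCM -polyCD -expr2 r2 -mulr2n -(mulr_natl 2%:R^-1) mulfV.
have [chi chiE] := presented_lift presS vrels.
by exists r, chi; split=> //; [exact: (chiE 0)|exact: (chiE 1)|exact: (chiE 2)].
Qed.

(* A morphism to [k[t]] killing [f T] sends [f X] and [f Y], whose product is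
   invertible there, and hence all of S to constants. *)
Lemma chi_aut_T (chi : {lrmorphism S -> {poly k}}) (f : algAut S) :
  chi T = 'X -> chi (f T) != 0.
Proof.
move=> chiT; apply/eqP => fT0.
have XY : chi (f X) * chi (f Y) *+ 2 = 1.
  have e : chi (f (X * Y + Y * X)) = 1 by rewrite ore_XY (rmorph1 f) rmorph1.
  rewrite -e [f (_ + _)]rmorphD rmorphD /= ![f (_ * _)]rmorphM /= !rmorphM /=.
  by rewrite mulr2n [chi (f Y) * _]mulrC.
have X0 : chi (f X) != 0.
  by apply/eqP => e; move/eqP: XY; rewrite e mul0r mul0rn eq_sym oner_eq0.
have Y0 : chi (f Y) != 0.
  by apply/eqP => e; move/eqP: XY; rewrite e mulr0 mul0rn eq_sym oner_eq0.
have sXY : size (chi (f X) * chi (f Y)) = 1%N.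
  by rewrite -(@size_scale _ 2%:R) // scaler_nat XY size_poly1.
have [sX sY] : (size (chi (f X)) <= 1)%N /\ (size (chi (f Y)) <= 1)%N.
  move: X0 Y0 sXY; rewrite -!size_poly_gt0 => X0 Y0.
  rewrite size_mul -?size_poly_gt0 //.
  by move: X0 Y0; case: (size _) => [|[|m]] //;
    case: (size _) => [|[|n]] //; rewrite addnS.
have sM (p q : {poly k}) : (size p <= 1 -> size q <= 1 -> size (p * q)%R <= 1)%N.
  by move=> sp sq; apply: leq_trans (size_polyMleq _ _) _; lia.
have sf a : (size (chi (f a)) <= 1)%N.
  elim/swap_ore_ind: a => [|c a IH|a b IHa IHb|a IH|a IH|a IH].
  - by rewrite !rmorph1 size_poly1.
  - by rewrite linearZ_LR linearZ_LR (leq_trans (size_scale_leq _ _)).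
  - by rewrite raddfD raddfD (leq_trans (size_polyD _ _)) // geq_max IHa.
  - by rewrite rmorphM rmorphM sM.
  - by rewrite rmorphM rmorphM sM.
  - by rewrite rmorphM rmorphM /= fT0 mul0r size_poly0.
(* By surjectivity T is a value of f, but [chi T] has size 2. *)
by have := sf ((f^-1)%g T); rewrite autVK chiT size_polyX.
Qed.

Lemma swap_ore_comm n : n * X = X * n -> n * Y = Y * n -> n * T = T * n ->
  forall a, n * a = a * n.
Proof.
move=> nX nY nT; elim/swap_ore_ind => [|c a IH|a b IHa IHb|a IH|a IH|a IH].
- by rewrite mulr1 mul1r.
- by rewrite -scalerAr IH scalerAl.
- by rewrite mulrDr IHa IHb mulrDl.
- by rewrite mulrA nX -!mulrA IH.
- by rewrite mulrA nY -!mulrA IH.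
- by rewrite mulrA nT -!mulrA IH.
Qed.

(** As s exchanges the two degrees, adding the degree equations for a = c s(a) leaves total degree 0
    for c. *)
Lemma xydeg_eigen (c a : A) : a != 0 -> a = c * s a -> exists d, c = d%:A.
Proof.
move=> a0 ac; have sa0 : s a != 0 by rewrite (swap_eq0 presA sx sy).
have c0 : c != 0 by apply: contraNneq a0 => c0; rewrite ac c0 mul0r.
apply: (deg00 two_neq0 sx sy (presA := presA)).
  have := xdegM two_neq0 presA c0 sa0; have := ydegM two_neq0 presA sx sy c0 sa0.
  by rewrite -ac /ydeg (swapK presA sx sy); lia.
have := xdegM two_neq0 presA c0 sa0; have := ydegM two_neq0 presA sx sy c0 sa0.
by rewrite -ac /ydeg (swapK presA sx sy); lia.
Qed.

Lemma aut_T_coef0 (f : algAut S) : cf (f T) 0 = 0.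
Proof.
apply/eqP/negPn/negP => n0; set n := f T in n0.
have nn : normal n := aut_normal f normal_T.
have [r [chi [r0 chiX chiY chiT]]] := chi_exists.
have chin : chi n != 0 := chi_aut_T f chiT.
have neg0 (p : {poly k}) : p = - p -> p = 0.
  move=> /eqP; rewrite -addr_eq0 -mulr2n -scaler_nat scaler_eq0 (negbTE two_neq0).
  by move=> /eqP.
(* In the commutative ring k[t] a minus sign would give 2 r [chi n] = 0. *)
have anti a : chi a = r%:P -> n * a <> - (a * n).
  move=> ca /(congr1 chi); rewrite raddfN /= !rmorphM /= ca [in LHS]mulrC.
  move=> e; move/eqP: (neg0 _ e).
  by rewrite mulf_eq0 polyC_eq0 (negbTE r0) (negbTE chin).
have [[nX|/(anti _ chiX) //] [nY|/(anti _ chiY) //]] := normal_gens_image nn n0.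
have [t' nT] := nn T.
have n1 : n != 0 by apply: contraNneq n0 => ->; rewrite coef0.
have T0 : T != 0 :> S by rewrite -size_poly_gt0 size_polyX.
have t'0 : t' != 0.
  by apply/eqP => t'0; have := ore_mulf_neq0 domA n1 T0; rewrite nT t'0 mul0r eqxx.
have st' : sz t' = 2%N.
  have sT : sz T = 2%N by rewrite size_polyX.
  have sn : (0 < sz n)%N by rewrite size_poly_gt0.
  by have := sizeM n1 T0; rewrite nT sizeM // sT; lia.
(* The product n T has constant coefficient 0 while that of n is nonzero, so the constant
   coefficient of t' vanishes. *)
have [q t'E] : exists q, t' = q * T.
  apply: coef0_eq0; apply/eqP; have : cf t' 0 * cf n 0 = 0.
    by rewrite -coef0_oreM -nT coef0_T.
  by move=> /domA [] /eqP // e; rewrite e in n0.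
have q0 : q != 0 by apply: contraNneq t'0 => q0; rewrite t'E q0 mul0r.
have qE : q = inj (cf q 0).
  have sT : sz T = 2%N by rewrite size_polyX.
  by apply: size1E; move: st'; rewrite t'E sizeM // sT; lia.
(* These are the coefficients of t in n T = q T n; they make q a scalar. *)
have : cf n 0 = cf q 0 * s (cf n 0).
  have := congr1 (fun p => cf p 1) nT; rewrite coef_oreMt => e.
  by rewrite [LHS]e t'E {1}qE -mulrA coef_ore_injM coef_oretM.
move=> /(xydeg_eigen n0) [d qd].
have nT1 : n * T = d *: (T * n).
  by rewrite nT t'E qE qd linearZ_LR /= rmorph1 mulr_algl -scalerAl.
(* In the commutative ring k[t], the image of n T = d T n under [chi] leaves only d = 1. *)
have d1 : d = 1.
  have := congr1 chi nT1; rewrite linearZ_LR !rmorphM /= chiT mulrC => /eqP.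
  rewrite -subr_eq0 -[X in X - _]scale1r -scalerBl scaler_eq0 mulf_eq0.
  by rewrite polyX_eq0 (negbTE chin) !orbF subr_eq0 => /eqP.
rewrite d1 scale1r in nT1.
have ncomm := swap_ore_comm nX nY nT1.
(* This is the image of T X = Y T under f, with n = f T now central; cancelling n would give x =
   y. *)
have : f X * n = f Y * n by rewrite -ncomm /n -!rmorphM ore_TX.
move=> /eqP; rewrite -subr_eq0 -mulrBl => XYn.
have fXY : f X = f Y.
  apply/eqP; rewrite -subr_eq0; apply: contraTT XYn => XY0.
  exact: (ore_mulf_neq0 domA XY0 n1).
have xy : x = y by apply: polyC_inj; apply: (bij_inj (aut_bij f)) fXY.
by have := x2_neq_y2 two_neq0 presA; rewrite xy subrr eqxx.
Qed.

(** With f(t) = U t and f^-1(t) = V t, applying f to the second equation gives f(V) U = 1, so U is a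
    scalar. *)
Lemma aut_T (f : algAut S) : exists2 c : k, c != 0 & f T = c *: T.
Proof.
have [U fT] := coef0_eq0 (aut_T_coef0 f).
have [V gT] := coef0_eq0 (aut_T_coef0 (f^-1)%g).
have /ore_unit [c Uc] : f V * U = 1.
  by apply: ore_TI; rewrite -mulrA -fT -rmorphM -gT /= autVK mul1r.
exists c; last by rewrite fT Uc mulr_algl.
apply: contraTneq (oner_neq0 S) => c0.
rewrite negbK -size_poly_eq0; have /eqP := fT; rewrite Uc c0 scale0r mul0r.
rewrite -(raddf0 f) (inj_eq (bij_inj (aut_bij f))) => /eqP T0.
by have := size_polyX A; rewrite [X in size (polyseq X)]T0 size_poly0.
Qed.

(** * The image of z under an automorphism *)

Lemma gens_image_same_sign (n : A) : n != 0 ->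
  n * x = - (x * n) -> n * y = y * n -> False.
Proof.
(* Moving n across x y + y x = 1 changes the sign of both terms. *)
move=> n0 nx ny; have nN : n = - n.
  rewrite -{1}[n]mulr1 -(W2_xy_eq presA) mulrDr !mulrA nx ny mulNr.
  rewrite -[x * n * y]mulrA ny -[y * n * x]mulrA nx mulrN !mulrA -opprD -mulrDl.
  by rewrite (W2_xy_eq presA) mul1r.
move/eqP: nN; rewrite -addr_eq0 -mulr2n.
by rewrite -scaler_nat scaler_eq0 (negbTE two_neq0) (negbTE n0).
Qed.

Lemma expg_swap i a : (s ^+ i)%g a = if odd i then s a else a.
Proof.
elim: i a => [|i IH] a; first by rewrite expg0.
rewrite expgSr -[LHS]/((s ^+ i)%g (s a)) IH /= (swapK presA sx sy).
by case: (odd i).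
Qed.

(** The coefficient of t^i sees x and y through s^i. For even i it anticommutes with x and
    [anticomm_dvd] applies; for odd i it is killed by x^2 - y^2 and vanishes. *)
Lemma anticomm_z_dvd (n : S) : n * X = - (X * n) -> n * Y = - (Y * n) ->
  exists q, n = inj z * q.
Proof.
move=> nX nY.
have cX i : cf n i * (s ^+ i)%g x = - (x * cf n i).
  by have := congr1 (fun p => cf p i) nX; rewrite coefN coef_oreM_inj coef_ore_injM.
have cY i : cf n i * (s ^+ i)%g y = - (y * cf n i).
  by have := congr1 (fun p => cf p i) nY; rewrite coefN coef_oreM_inj coef_ore_injM.
have dvd i : exists b, cf n i = z * b.
  have := cX i; have := cY i; rewrite !expg_swap; case: (odd i) => [|_].
    rewrite sx sy => nx ny; exists 0; rewrite mulr0.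
    have : (x ^+ 2 - y ^+ 2) * cf n i = 0.
      (* The element y^2 is central, as the image of x^2 under the swap. *)
      have y2 a : y ^+ 2 * a = a * y ^+ 2.
        rewrite -[a](swapK presA sx sy) -sx -rmorphXn /= -!rmorphM /=.
        by rewrite (W2_comm_x2 presA).
      rewrite mulrBl y2 !expr2 mulrA ny mulNr -[x * cf n i * y]mulrA ny.
      by rewrite mulrN opprK mulrA subrr.
    by move=> /domA [] // /eqP; rewrite (negbTE (x2_neq_y2 two_neq0 presA)).
  exact: (anticomm_dvd presA).
pose b i := projT1 (cid (dvd i)).
have bE i : cf n i = z * b i by rewrite /b; case: cid.
exists (\poly_(i < sz n) b i : {poly A}); apply/polyP => i.
rewrite coef_ore_injM coef_poly; case: ltnP => // ni.
by rewrite mulr0 nth_default.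
Qed.

Lemma aut_z_anticomm (f : algAut S) :
  f (inj z) * X = - (X * f (inj z)) /\ f (inj z) * Y = - (Y * f (inj z)).
Proof.
set n := f (inj z); have nn : normal n := aut_normal f normal_z.
have z0 := gen_z_neq0 two_neq0 presA sx sy.
(* Otherwise n has a right factor t, and f^-1, which only scales t, would give z one as well. *)
have n0 : cf n 0 != 0.
  apply/eqP => /coef0_eq0 [q nE]; have [c c0 fT] := aut_T (f^-1)%g.
  have : cf (inj z) 0 = 0.
    by rewrite -(autKV f (inj z)) -/n nE rmorphM /= fT -scalerAr scalerAl coef0_T.
  by rewrite coefC => /eqP; rewrite (negbTE z0).
have cf0 a : cf (n * inj a) 0 = cf n 0 * a by rewrite coef0_oreM coefC.
have cf0' a : cf (inj a * n) 0 = a * cf n 0 by rewrite coef0_oreM coefC.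
have [[nX|nX] [nY|nY]] := normal_gens_image nn n0; last by [].
(* With two plus signs n_0 is central in W_2. Then z x = -x z forces the constant coefficient of
   f(x) to be 0, which contradicts f(x) f(y) + f(y) f(x) = 1. *)
- have nx : cf n 0 * x = x * cf n 0 by rewrite -cf0 -cf0' nX.
  have ny : cf n 0 * y = y * cf n 0 by rewrite -cf0 -cf0' nY.
  have ncomm a : cf n 0 * a = a * cf n 0.
    elim/(W2_ind presA): a => [|c a IH|a b IHa IHb|a IH|a IH].
    - by rewrite mulr1 mul1r.
    - by rewrite -scalerAr IH scalerAl.
    - by rewrite mulrDr IHa IHb mulrDl.
    - by rewrite mulrA nx -!mulrA IH.
    - by rewrite mulrA ny -!mulrA IH.
  have : cf (f X) 0 = 0.
    have : n * f X = - (f X * n).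
      rewrite /n -!rmorphM -raddfN; congr (f _).
      by rewrite -raddfN (z_x presA) opprK.
    move=> /(congr1 (fun p => cf p 0)); rewrite coefN !coef0_oreM ncomm => /eqP.
    rewrite -addr_eq0 -mulr2n -scaler_nat scaler_eq0 (negbTE two_neq0) /= => /eqP.
    by move=> /domA [] // /eqP; rewrite (negbTE n0).
  have := congr1 (fun p => cf (f p) 0) ore_XY.
  rewrite rmorphD rmorph1 !rmorphM /= coefD !coef0_oreM => + fX0.
  by rewrite fX0 mul0r mulr0 addr0 coefC => /eqP; rewrite eq_sym oner_eq0.
(* The swap reduces this mixed case to the other one. *)
- have nx : s (cf n 0) * y = y * s (cf n 0).
    by rewrite -sx -!rmorphM /= -cf0 -cf0' nX.
  have ny : s (cf n 0) * x = - (x * s (cf n 0)).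
    by rewrite -sy -!rmorphM -raddfN /= -cf0 -cf0' nY coefN.
  by case: (gens_image_same_sign _ ny nx); rewrite (swap_eq0 presA sx sy).
have nx : cf n 0 * x = - (x * cf n 0) by rewrite -cf0 -cf0' nX coefN.
have ny : cf n 0 * y = y * cf n 0 by rewrite -cf0 -cf0' nY.
by case: (gens_image_same_sign n0 nx ny).
Qed.

(** With f(z) = z U and f^-1(z) = z V one gets U f(V) = 1. Since [ore_unit] makes the right factor a
    scalar, f^-1(z) is determined first and then inverted. *)
Lemma aut_z (f : algAut S) : exists2 c : k, c != 0 & f (inj z) = c *: inj z.
Proof.
have [/anticomm_z_dvd fX /fX [U fz]] := aut_z_anticomm f.
have [/anticomm_z_dvd gX /gX [V gz]] := aut_z_anticomm (f^-1)%g.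
have z0 : inj z != 0.
  by rewrite -size_poly_gt0 size_polyC (gen_z_neq0 two_neq0 presA sx sy).
have /ore_unit [c Vc] : U * f V = 1.
  have : inj z * (U * f V - 1) = 0.
    by rewrite mulrBr mulr1 mulrA -fz -rmorphM -gz /= autVK subrr.
  move=> zU; apply/eqP; rewrite -subr_eq0; apply/negPn/negP => U0.
  by have := ore_mulf_neq0 domA z0 U0; rewrite zU eqxx.
have c0 : c != 0.
  apply: contraTneq (oner_neq0 S) => c0; rewrite negbK.
  have gz0 : (f^-1)%g (inj z) = 0.
    rewrite gz -[V](autKV f) Vc c0 scale0r.
    by rewrite raddf0 mulr0.
  have : inj z = 0 by rewrite -(autVK f (inj z)) gz0 raddf0.
  by move/eqP; rewrite (negbTE z0).
have gz' : (f^-1)%g (inj z) = c *: inj z.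
  by rewrite gz -[V](autKV f) Vc linearZ_LR /= rmorph1 mulr_algr.
exists c^-1; first by rewrite invr_eq0.
have : f ((f^-1)%g (inj z)) = c *: f (inj z) by rewrite gz' linearZ_LR.
by rewrite autVK => e; rewrite [in RHS]e scalerA mulVf // scale1r.
Qed.

(** The product f(x) f(y) = (1 + d z) / 2 lies in W_2, hence so do both factors, and [W2_pair] lists
    them. The relation t x = y t makes their two scalars equal, so that e^2 = 1. *)
Lemma aut_classify (f : algAut S) : exists c e : k,
  [/\ c != 0, e * e = 1, f T = c *: T &
     (f X = e *: X /\ f Y = e *: Y) \/ (f X = e *: Y /\ f Y = e *: X)].
Proof.
have [c c0 fT] := aut_T f; have [d d0 fz] := aut_z f.
have XY1 : f X * f Y + f Y * f X = 1.
  by rewrite -(rmorph1 f) -ore_XY rmorphD /= !rmorphM.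
have XYz : f X * f Y - f Y * f X = d *: inj z.
  have zE : inj z = X * Y - Y * X by rewrite raddfB /= !rmorphM.
  by rewrite -fz [in RHS]zE rmorphB /= !rmorphM.
have z0 : inj z != 0.
  by rewrite -size_poly_gt0 size_polyC (gen_z_neq0 two_neq0 presA sx sy).
have dz0 : d *: inj z != 0 by rewrite scaler_eq0 (negbTE d0) (negbTE z0).
have fX0 : f X != 0 by apply: contraNneq dz0 => e; rewrite -XYz e mul0r mulr0 subrr.
have fY0 : f Y != 0 by apply: contraNneq dz0 => e; rewrite -XYz e mul0r mulr0 subrr.
have XYE : f X * f Y = inj (2%:R^-1 *: (1 + d *: z)).
  rewrite linearZ_LR raddfD /= linearZ_LR /= rmorph1 -XYz -XY1 addrACA subrr addr0.
  by rewrite -mulr2n -scaler_nat scalerA mulVf // scale1r.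
have [a fXa] : exists a, f X = inj a.
  exists (cf (f X) 0); apply: size1E.
  have sX : (0 < sz (f X))%N by rewrite size_poly_gt0.
  have sY : (0 < sz (f Y))%N by rewrite size_poly_gt0.
  have := sizeM fX0 fY0; rewrite XYE => sXY.
  have : (sz (inj (2%:R^-1 *: (1 + d *: z))) <= 1)%N by exact: size_polyC_leq1.
  rewrite sXY; lia.
have [b fYb] : exists b, f Y = inj b.
  exists (cf (f Y) 0); apply: size1E.
  have sX : (0 < sz (f X))%N by rewrite size_poly_gt0.
  have sY : (0 < sz (f Y))%N by rewrite size_poly_gt0.
  have := sizeM fX0 fY0; rewrite XYE => sXY.
  have : (sz (inj (2%:R^-1 *: (1 + d *: z))) <= 1)%N by exact: size_polyC_leq1.
  rewrite sXY; lia.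
(* Apply f to t x = y t, move t to the right past a, and cancel c and t. *)
have sab : s a = b.
  have := congr1 f ore_TX; rewrite !rmorphM /= fT fXa fYb -scalerAl -scalerAr ore_tM.
  move=> /(congr1 (fun p => c^-1 *: p)); rewrite !scalerA mulVf // !scale1r.
  by move=> /ore_TI /polyC_inj.
have ab1 : a * b + b * a = 1.
  by apply: polyC_inj; move: XY1; rewrite fXa fYb -!rmorphM -raddfD.
have abz : a * b - b * a = d *: z.
  by apply: polyC_inj; move: XYz; rewrite fXa fYb -!rmorphM -raddfB -linearZ_LR.
have [e [e' [ee' [[aE bE]|[aE bE]]]]] := W2_pair two_neq0 presA sx sy ab1 abz d0.
  have e'E : e = e'.
    apply/eqP; rewrite -subr_eq0.
    have : (e - e') *: y = 0 by rewrite scalerBl -bE -sab aE linearZ_LR /= sx subrr.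
    by move=> /eqP; rewrite scaler_eq0 (negbTE (gen_y_neq0 presA)) orbF.
  exists c, e; split=> //; first by rewrite {2}e'E.
  by left; rewrite fXa fYb aE bE -e'E !linearZ_LR.
have e'E : e = e'.
  apply/eqP; rewrite -subr_eq0.
  have : (e - e') *: x = 0 by rewrite scalerBl -bE -sab aE linearZ_LR /= sy subrr.
  by move=> /eqP; rewrite scaler_eq0 (negbTE (gen_x_neq0 two_neq0 presA)) orbF.
exists c, e; split=> //; first by rewrite {2}e'E.
by right; rewrite fXa fYb aE bE -e'E !linearZ_LR.
Qed.

(** * Construction of automorphisms *)

Lemma aut_ext (f g : algAut S) : f X = g X -> f Y = g Y -> f T = g T -> f = g.
Proof.
move=> fX fY fT; apply: algAutP.
elim/swap_ore_ind => [|c a IH|a b IHa IHb|a IH|a IH|a IH].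
- by rewrite !rmorph1.
- by rewrite !linearZ_LR /= IH.
- by rewrite !raddfD /= IHa IHb.
- by rewrite !rmorphM /= fX IH.
- by rewrite !rmorphM /= fY IH.
- by rewrite !rmorphM /= fT IH.
Qed.

Lemma endo_exists (a b d : S) : a * b + b * a = 1 -> d * a = b * d -> d * b = a * d ->
  exists f : {lrmorphism S -> S}, [/\ f X = a, f Y = b & f T = d].
Proof.
move=> ab da db; pose v := tnth [tuple a; b; d].
have [v0 v1 v2] : [/\ v 0 = a, v 1 = b & v 2 = d] by [].
have vrels : forall i, i \in S_rels k -> freeEval v i = 0.
  by apply: (proj2 (S_rels_eval v)); rewrite v0 v1 v2.
have [f fE] := presented_lift presS vrels.
by exists f; split; [exact: (fE 0)|exact: (fE 1)|exact: (fE 2)].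
Qed.

Lemma endo_id (f : {lrmorphism S -> S}) : f X = X -> f Y = Y -> f T = T -> f =1 id.
Proof.
move=> fX fY fT; elim/swap_ore_ind => [|c a IH|a b IHa IHb|a IH|a IH|a IH].
- by rewrite rmorph1.
- by rewrite linearZ_LR /= IH.
- by rewrite raddfD /= IHa IHb.
- by rewrite rmorphM /= fX IH.
- by rewrite rmorphM /= fY IH.
- by rewrite rmorphM /= fT IH.
Qed.

Lemma aut_of_endo (f g : {lrmorphism S -> S}) :
  g (f X) = X -> g (f Y) = Y -> g (f T) = T ->
  f (g X) = X -> f (g Y) = Y -> f (g T) = T ->
  exists h : algAut S, h =1 f.
Proof.
move=> gX gY gT fX fY fT.
have fK : cancel f g := @endo_id (g \o f) gX gY gT.
have gK : cancel g f := @endo_id (f \o g) fX fY fT.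
have fl : linear f by move=> c a b; rewrite linearP.
have fm : GRing.monoid_morphism f by split=> [|a b]; rewrite ?rmorph1 ?rmorphM.
by exists (AlgAut fl fm (Bijective fK gK)).
Qed.

Lemma scale_aut_exists (c e : k) : c != 0 -> e * e = 1 -> exists f : algAut S,
  [/\ f X = e *: X, f Y = e *: Y & f T = c *: T].
Proof.
have endo (d : k) : e * e = 1 -> exists f : {lrmorphism S -> S},
    [/\ f X = e *: X, f Y = e *: Y & f T = d *: T].
  move=> ee; apply: endo_exists.
  - by rewrite -!scalerAl -!scalerAr !scalerA ee !scale1r ore_XY.
  - by rewrite -!scalerAl -!scalerAr !scalerA ore_TX mulrC.
  - by rewrite -!scalerAl -!scalerAr !scalerA ore_TY mulrC.
move=> c0 ee; have [f [fX fY fT]] := endo c ee.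
(* Since e e = 1, the inverse scales x and y by the same e. *)
have [g [gX gY gT]] := endo c^-1 ee.
have [||||||h hf] := @aut_of_endo f g;
  rewrite ?fX ?fY ?fT ?gX ?gY ?gT ?linearZ_LR /= ?fX ?fY ?fT ?gX ?gY ?gT
    ?scalerA ?ee ?mulfV ?mulVf ?scale1r //.
by exists h; rewrite !hf.
Qed.

Lemma swap_aut_exists : exists f : algAut S, [/\ f X = Y, f Y = X & f T = T].
Proof.
have [f [fX fY fT]] : exists f : {lrmorphism S -> S}, [/\ f X = Y, f Y = X & f T = T].
  by apply: endo_exists; rewrite ?ore_TX ?ore_TY // addrC ore_XY.
have [||||||h hf] := @aut_of_endo f f; rewrite ?fX ?fY ?fT //.
by exists h; rewrite !hf.
Qed.

Lemma sign_sqr (e : signs k) : unit_val e * unit_val e = 1.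
Proof.
by case: e => e /=; rewrite /is_sign => /orP[] /eqP ->; rewrite ?mulrNN mulr1.
Qed.

Definition scale_aut (p : (fieldUnits k * signs k)%type) : algAut S :=
  projT1 (cid (scale_aut_exists (unit_val_neq0 p.1) (sign_sqr p.2))).

Lemma scale_autE p :
  [/\ scale_aut p X = unit_val p.2 *: X, scale_aut p Y = unit_val p.2 *: Y
    & scale_aut p T = unit_val p.1 *: T].
Proof. by rewrite /scale_aut; case: cid. Qed.

Lemma autME (f g : algAut S) a : (f * g)%g a = f (g a). Proof. by []. Qed.

Lemma scale_autM p q : scale_aut (p * q)%g = (scale_aut p * scale_aut q)%g.
Proof.
have [X1 Y1 T1] := scale_autE (p * q)%g.
have [X2 Y2 T2] := scale_autE p; have [X3 Y3 T3] := scale_autE q.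
apply: aut_ext; rewrite [RHS]autME.
- by rewrite X1 X3 linearZ_LR /= X2 scalerA mulrC.
- by rewrite Y1 Y3 linearZ_LR /= Y2 scalerA mulrC.
- by rewrite T1 T3 linearZ_LR /= T2 scalerA mulrC.
Qed.

(** The swap commutes with the scalings, which multiply x and y by the same sign, so the semidirect
    product is formed with the trivial action. *)
Definition trivial_act (N H : groupType) : groupAct N H :=
  @GroupAct N H (fun _ a => a) (fun _ _ _ => erefl) (fun _ => erefl)
    (fun _ _ _ => erefl).

(** * The automorphism group as a semidirect product *)

Section Swap.
Variable tau : algAut S.
Hypotheses (tX : tau X = Y) (tY : tau Y = X) (tT : tau T = T).

Lemma swap_autK : (tau * tau)%g = 1%g.
Proof.
apply: aut_ext; rewrite [LHS]autME [RHS]/=.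
- by rewrite tX tY.
- by rewrite tY tX.
- by rewrite !tT.
Qed.

Lemma scale_swapC p : (scale_aut p * tau = tau * scale_aut p)%g.
Proof.
have [X1 Y1 T1] := scale_autE p.
apply: aut_ext; rewrite [LHS]autME [RHS]autME.
- by rewrite tX X1 Y1 linearZ_LR /= tX.
- by rewrite tY X1 Y1 linearZ_LR /= tY.
- by rewrite tT T1 linearZ_LR /= tT.
Qed.

Lemma cyclic_swap (h : cyclicGroup tau) : val h = 1%g \/ val h = tau.
Proof.
have /asboolP cyc := valP h.
have tV : (tau^-1)%g = tau by rewrite -[LHS]mulg1 -swap_autK mulKg.
(* Membership in every subgroup containing [tau] is tested on the set of 1 and [tau], a subgroup
   because [tau] is its own inverse. *)
have /orP[/eqP|/eqP] : val h \in [pred g | (g == 1%g) || (g == tau)].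
- apply: cyc; last by rewrite inE eqxx orbT.
  split=> [|a b]; first by rewrite inE eqxx.
  rewrite !inE => /orP[] /eqP -> /orP[] /eqP ->;
    by rewrite ?invg1 ?tV ?mulg1 ?mul1g ?swap_autK ?eqxx ?orbT.
- by left.
by right.
Qed.

Lemma swap_in_cyclic : in_cyclic tau tau.
Proof. by apply/asboolP. Qed.

Lemma scale_cyclicC p (h : cyclicGroup tau) :
  (scale_aut p * val h = val h * scale_aut p)%g.
Proof.
by case: (cyclic_swap h) => ->; [rewrite mulg1 mul1g|apply: scale_swapC].
Qed.

Definition aut_of (p : sdprod (trivial_act (fieldUnits k * signs k)%type
    (cyclicGroup tau))) : algAut S := (scale_aut p.1 * val p.2)%g.

Fact aut_of_morph : {morph aut_of : p q / (p * q)%g}.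
Proof.
move=> p q; rewrite /aut_of [(p * q)%g.1]/= [(p * q)%g.2]/= scale_autM gmulfM.
by rewrite !mulgA; congr (_ * _)%g; rewrite -!mulgA scale_cyclicC.
Qed.

HB.instance Definition _ := isMultiplicative.Build _ _ aut_of aut_of_morph.

Lemma scaleI (a b : k) (c : S) : c != 0 -> a *: c = b *: c -> a = b.
Proof.
move=> c0 /eqP; rewrite -subr_eq0 -scalerBl scaler_eq0 (negbTE c0) orbF subr_eq0.
by move=> /eqP.
Qed.

Lemma aut_ofT p : aut_of p T = unit_val p.1.1 *: T.
Proof.
have [_ _ pT] := scale_autE p.1; rewrite [LHS]autME.
by case: (cyclic_swap p.2) => ->; rewrite ?tT pT.
Qed.

Lemma aut_ofX p : aut_of p X = unit_val p.1.2 *: (if val p.2 == 1%g then X else Y).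
Proof.
have [pX pY _] := scale_autE p.1; rewrite [LHS]autME.
case: eqP => [->|]; first by rewrite pX.
by case: (cyclic_swap p.2) => -> // _; rewrite tX pY.
Qed.

Lemma sign_neq0 (e : signs k) : unit_val e != 0.
Proof. exact: unit_val_neq0. Qed.

(** The value at t recovers the unit; the value at x recovers the sign and the power of [tau],
    because x and y are linearly independent. *)
Lemma aut_of_inj : injective aut_of.
Proof.
move=> [[c e] h] [[c' e'] h'] pq.
have T0 : T != 0 by rewrite -size_poly_gt0 size_polyX.
have X0 : X != 0 by rewrite -size_poly_gt0 size_polyC (gen_x_neq0 two_neq0 presA).
have Y0 : Y != 0 by rewrite -size_poly_gt0 size_polyC (gen_y_neq0 presA).
have XY (a b : k) : a != 0 -> a *: X <> b *: Y.
  move=> a0; rewrite -!linearZ_LR /= => /polyC_inj ab.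
  have : 0%:A + a *: x + (- b) *: y = 0 by rewrite scale0r add0r scaleNr ab subrr.
  by move=> /(W2_affine_indep presA) [_ a0' _]; rewrite a0' eqxx in a0.
have cc : c = c'.
  apply: val_inj; apply: (scaleI T0).
  by have := congr1 (fun f : algAut S => f T) pq; rewrite !aut_ofT.
have := congr1 (fun f : algAut S => f X) pq; rewrite !aut_ofX /=.
have hE (g g' : cyclicGroup tau) : (val g == 1%g) = (val g' == 1%g) -> g = g'.
  move=> gg; apply: val_inj; move: gg.
  case: (cyclic_swap g) (cyclic_swap g') => -> [] -> //; rewrite eqxx => /esym.
    by move/eqP.
  by move=> /esym/eqP.
case: ifP => h1; case: ifP => h1'.
- move=> /(scaleI X0) ee; rewrite cc (hE h h') ?h1 ?h1' //.
  by congr (_, _, _); apply/val_inj/val_inj.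
- by move=> /(XY _ _ (sign_neq0 e)).
- by move=> /esym /(XY _ _ (sign_neq0 e')).
move=> /(scaleI Y0) ee; rewrite cc (hE h h') ?h1 ?h1' //.
by congr (_, _, _); apply/val_inj/val_inj.
Qed.

Lemma aut_of_surj f : exists p, aut_of p = f.
Proof.
have [c [e [c0 ee fT fXY]]] := aut_classify f.
have e0 : e != 0 by apply: contra_eq_neq ee => ->; rewrite mul0r eq_sym oner_neq0.
have se : is_sign (FieldUnit e0) by rewrite /is_sign /= -sqrf_eq1 expr2 ee.
have [pX pY pT] := scale_autE (FieldUnit c0, Sign se).
case: fXY => -[fX fY].
  exists ((FieldUnit c0, Sign se), 1%g); rewrite /aut_of /= mulg1.
  by apply: aut_ext; rewrite ?pX ?pY ?pT.
exists ((FieldUnit c0, Sign se), CyclicGroup swap_in_cyclic); rewrite /aut_of /=.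
by apply: aut_ext; rewrite [LHS]autME ?tX ?tY ?tT ?pX ?pY ?pT.
Qed.

Lemma aut_of_bij : bijective aut_of.
Proof.
pose g f := projT1 (cid (aut_of_surj f)).
have gK : cancel g aut_of by move=> f; rewrite /g; case: cid.
by exists g => // p; apply: aut_of_inj; rewrite gK.
Qed.

Lemma aut_of_cyclic (h : cyclicGroup tau) : aut_of (1%g, h) = val h.
Proof.
(* The automorphism [scale_aut 1] is idempotent, hence the identity. *)
rewrite /aut_of -(mulgK (scale_aut 1%g) (scale_aut 1%g)).
by rewrite -scale_autM mulg1 mulgV mul1g.
Qed.

End Swap.

Lemma swap_ore_aut_group : exists tau : algAut S,
  [/\ tau X = Y, tau Y = X, tau T = T
    & exists (theta : groupAct (fieldUnits k * signs k)%type (cyclicGroup tau))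
             (f : {multiplicative sdprod theta -> algAut S}),
        bijective f /\ (forall h : cyclicGroup tau, f (1%g, h) = val h)].
Proof.
have [tau [tX tY tT]] := swap_aut_exists; exists tau; split=> //.
pose theta := trivial_act (fieldUnits k * signs k)%type (cyclicGroup tau).
pose f : {multiplicative sdprod theta -> algAut S} := @aut_of tau.
exists theta, (f tX tY tT).
by split; [exact: aut_of_bij|exact: aut_of_cyclic].
Qed.

End SwapOreAutomorphisms.

Theorem proposition8p4 (k : closedFieldType) (char0 : [pchar k] =i pred0) :
  presented_by (S_gen k) (S_rels k) /\
  exists tau : algAut (Salg k),
    [/\ tau (Sx k) = Sy k, tau (Sy k) = Sx k, tau (St k) = St k
      & exists (theta : groupAct (fieldUnits k * signs k)%type
                                 (cyclicGroup tau))
               (f : {multiplicative sdprod theta -> algAut (Salg k)}),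
          bijective f /\
          (forall h : cyclicGroup tau, f (1%g, h) = val h)].
Proof.
have two_neq0 : 2%:R != 0 :> k by rewrite (proj1 (pcharf0P k) char0).
have presA := W2_presented k.
have sx := W2_swap_x k; have sy := W2_swap_y k.
split; first exact: (swap_ore_presented presA sx sy).
exact: (swap_ore_aut_group two_neq0 presA sx sy).
Qed.
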